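(* For any $z\in\mathbb{C}\setminus\mathbb{R}$, there is a unique vector $(g_1(z),\ldots,g_k(z))\in\mathbb{C}^k$ such that for each $a=1,\ldots,k$, $$\Im z\,\Im g_a(z)\ge0,\qquad \Im z\,\Im(zg_a(z))\ge0,\qquad c_0|g_a(z)|\le|\Im z|^{-1}$$ and $$c_0g_a(z)=-\frac1z\,\frac{1}{1+\tilde g_a(z)},\qquad \tilde g_a(z)=-\frac1z\,\frac1p\operatorname{tr}C_a\Big(I_p+\sum_{b=1}^kc_bg_b(z)C_b\Big)^{-1}.$$ Besides, the first two inequalities are in fact strict, and the functions $c_0g_a(z)$ ($a=1,\ldots,k$) are the Stieltjes transforms of some compactly supported probability measures $\nu_1,\ldots,\nu_k$ on $\mathbb{R}_+$.
   Context: $k,n,p,n_1,\ldots,n_k$ are positive integers with $n_1+\cdots+n_k=n$; $c_0=p/n$ and $c_a=n_a/n$ for $a=1,\ldots,k$; $C_1,\ldots,C_k$ are positive semi-definite $p\times p$ matrices. (In the paper, $k$ is fixed, the other integers tend to infinity with $c_0,c_1,\ldots,c_k$ bounded away from $0$ and $+\infty$, and the $C_a$ are bounded in operator norm by a constant.) The vector $(g_1(z),\ldots,g_k(z))$ depends implicitly on these parameters. The Stieltjes transform of a probability measure $\nu$ is $m_\nu(z)=\int\frac{\nu(\mathrm{d}t)}{t-z}$.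
   Formalization: The strict form of the second inequality, Im z · Im(z g_a(z)) > 0, is asserted only for those a with C_a ≠ 0: if C_a = 0 then c_0 g_a(z) = −1/z, so z g_a(z) is real and the product equals 0. *)

(* Defs.v *)
From HB Require Import structures.
From mathcomp Require Import all_boot all_order all_algebra.
From mathcomp Require Import all_classical all_reals all_analysis.
From mathcomp Require Import complex.

Set Implicit Arguments.
Unset Strict Implicit.
Unset Printing Implicit Defensive.

Import Order.TTheory GRing.Theory Num.Theory.
Import numFieldNormedType.Exports.

Local Open Scope ring_scope.
Local Open Scope complex_scope.
Local Open Scope sesquilinear_scope.
Local Open Scope classical_set_scope.

(* [0 <= w] for [w : R[i]] means that w is real and nonnegative. *)
Definition psdmx (R : realType) (p : nat) (A : 'M[R[i]]_p) : Prop :=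
  A \is hermsymmx /\ forall v : 'cV[R[i]]_p, 0 <= (v ^t* *m A *m v) 0 0.

(* [Rintegral] is real-valued, so the complex integral of 1 / (t - z) is taken
   componentwise; for non-real z the integrand is bounded and continuous. *)
Definition stieltjes (R : realType) (nu : probability (measurableTypeR R) R)
    (z : R[i]) : R[i] :=
  (\int[nu]_t complex.Re ((t%:C - z)^-1))
  +i* (\int[nu]_t complex.Im ((t%:C - z)^-1)).

Definition compactly_supported_in (R : realType)
    (nu : probability (measurableTypeR R) R) (D : set R) : Prop :=
  exists K : set R, [/\ compact K, K `<=` D & nu K = 1%E].

Section System.
Variables (R : realType) (k n p : nat) (ns : 'I_k -> nat).
Variable C : 'I_k -> 'M[R[i]]_p.
Implicit Types (z : R[i]) (g : 'rV[R[i]]_k).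

Definition dim_ratio : R := p%:R / n%:R.

Definition class_ratio (a : 'I_k) : R := (ns a)%:R / n%:R.

Definition resolvent_arg g : 'M[R[i]]_p :=
  1%:M + \sum_(b < k) ((class_ratio b)%:C * g 0 b) *: C b.

Definition gtilde z g (a : 'I_k) : R[i] :=
  - z^-1 * (p%:R^-1 * \tr (C a *m invmx (resolvent_arg g))).

(* Inverses are total in MathComp ([invmx A = A] for singular A, [0^-1 = 0]),
   so the equations are accompanied by the conditions under which their
   right-hand sides make sense. *)
Definition solution z g : Prop :=
  forall a : 'I_k,
    [/\ 0 <= complex.Im z * complex.Im (g 0 a),
        0 <= complex.Im z * complex.Im (z * g 0 a) &
        dim_ratio%:C * `|g 0 a| <= (`|complex.Im z|^-1)%:C] /\
    [/\ resolvent_arg g \in unitmx,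
        1 + gtilde z g a != 0 &
        dim_ratio%:C * g 0 a = - z^-1 * (1 + gtilde z g a)^-1].

End System.

(* Main.v *)
(** Fix z in the upper half plane; the lower one follows by conjugation. The
    system says that g is a fixed point of T, where T(g)_a = 1 / (c0 F_a(g)),
    F_a(g) = - z + (1/p) tr (C_a Q(g)) and Q(g) = (I + sum_b c_b g_b C_b)^-1.
    Expressing Im F by the resolvent identity, F(g) - F(h) likewise, and
    comparing the two by the Cauchy-Schwarz inequality, one sees that T
    contracts max_b |g_b - h_b|^2 / (Im g_b Im h_b) by a factor less than 1.
    This gives uniqueness, and the increments of the iterates of T tend to 0.

    Started from g = - 1 / (c0 z), the iterates multiplied by c0 are the Stieltjes
    transforms of finitely supported probability measures, independent of z:
    Woodbury's formula turns tr (C_a Q) into a combination of entries of the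
    resolvent of a Hermitian matrix, and 1 / F_a then is the corner entry of the
    resolvent of an arrowhead matrix. As Im (z T(g)_a) >= 0, and as
    c0 |T(g)_a| <= 2 / |z| for large |z|, the atoms stay in a fixed interval
    [0, M]. Passing to the limit of their distribution functions along an
    ultrafilter yields the measures nu_a. Their Stieltjes transforms are the
    limits of the iterates along the same ultrafilter, at all z at once; since
    the increments vanish, these limits form a fixed point of T. *)

Require Import Defs.
From HB Require Import structures.
From mathcomp Require Import all_boot all_order all_algebra.
From mathcomp Require Import all_classical all_reals all_analysis.
From mathcomp Require Import measurable_realfun complex ring lra.

Set Implicit Arguments.
Unset Strict Implicit.
Unset Printing Implicit Defensive.

Import Order.TTheory GRing.Theory Num.Theory.
Import numFieldNormedType.Exports Normc.

Local Open Scope ring_scope.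
Local Open Scope complex_scope.
Local Open Scope sesquilinear_scope.
Local Open Scope classical_set_scope.

(** * Complex numbers and matrices *)

Section ComplexScalars.
Variable R : realType.
Implicit Types (x y z w : R[i]) (r s : R).

Lemma ReD x y : complex.Re (x + y) = complex.Re x + complex.Re y.
Proof. by case: x; case: y. Qed.

Lemma ImD x y : complex.Im (x + y) = complex.Im x + complex.Im y.
Proof. by case: x; case: y. Qed.

Lemma ReN x : complex.Re (- x) = - complex.Re x.
Proof. by case: x. Qed.

Lemma ImN x : complex.Im (- x) = - complex.Im x.
Proof. by case: x. Qed.

Lemma ImZ r x : complex.Im (r%:C * x) = r * complex.Im x.
Proof. by case: x => a b /=; rewrite mul0r addr0. Qed.

Lemma ImZr r x : complex.Im (x * r%:C) = complex.Im x * r.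
Proof. by rewrite mulrC ImZ mulrC. Qed.

Lemma ReZ r x : complex.Re (r%:C * x) = r * complex.Re x.
Proof. by case: x => a b /=; rewrite mul0r subr0. Qed.

Lemma Im_sum (I : finType) (f : I -> R[i]) :
  complex.Im (\sum_i f i) = \sum_i complex.Im (f i).
Proof. exact: (big_morph _ ImD). Qed.

Lemma Re_sum (I : finType) (f : I -> R[i]) :
  complex.Re (\sum_i f i) = \sum_i complex.Re (f i).
Proof. exact: (big_morph _ ReD). Qed.

Lemma Im_conjc x : complex.Im x^*%C = - complex.Im x.
Proof. by case: x. Qed.

Lemma Im_Num_conj x : complex.Im x^*%R = - complex.Im x.
Proof. exact: Im_conjc. Qed.

Lemma natrC n : (n%:R : R[i]) = (n%:R)%:C.
Proof. by rewrite rmorph_nat. Qed.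

Lemma realCV r : (r%:C)^-1 = (r^-1)%:C.
Proof. by rewrite fmorphV. Qed.

Lemma realCD r s : (r + s)%:C = r%:C + s%:C.
Proof. exact: rmorphD. Qed.

Lemma realCN r : (- r)%:C = - r%:C.
Proof. exact: rmorphN. Qed.

Lemma realCM r s : (r * s)%:C = r%:C * s%:C.
Proof. exact: rmorphM. Qed.

Lemma realC_sum (I : finType) (f : I -> R) :
  (\sum_i f i)%:C = \sum_i (f i)%:C.
Proof. exact: rmorph_sum. Qed.

(** The squared modulus with values in [R]; the norm of [R[i]] takes its values in [R[i]]. *)
Definition sqn x : R := complex.Re x ^+ 2 + complex.Im x ^+ 2.

Lemma sqn_normc x : sqn x = normc x ^+ 2.
Proof.
by case: x => a b; rewrite /sqn /normc /= sqr_sqrtr // addr_ge0 ?sqr_ge0.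
Qed.

Lemma normc_ge0 x : 0 <= normc x.
Proof. by case: x => a b; exact: sqrtr_ge0. Qed.

Lemma normr_normc x : `|x| = (normc x)%:C.
Proof. by case: x. Qed.

Lemma sqn_ge0 x : 0 <= sqn x.
Proof. by rewrite sqn_normc sqr_ge0. Qed.

Lemma normc_eq0 x : (normc x == 0) = (x == 0).
Proof. by apply/eqP/eqP => [/eq0_normc//|->]; exact: normc0. Qed.

Lemma sqn_eq0 x : (sqn x == 0) = (x == 0).
Proof. by rewrite sqn_normc sqrf_eq0 normc_eq0. Qed.

Lemma sqn_gt0 x : (0 < sqn x) = (x != 0).
Proof. by rewrite lt0r sqn_eq0 sqn_ge0 andbT. Qed.

Lemma sqnM x y : sqn (x * y) = sqn x * sqn y.
Proof. by rewrite !sqn_normc normcM exprMn. Qed.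

Lemma sqnV x : sqn x^-1 = (sqn x)^-1.
Proof. by rewrite !sqn_normc normcV exprVn. Qed.

Lemma sqn_real r : sqn r%:C = r ^+ 2.
Proof. by rewrite /sqn /= expr0n addr0. Qed.

Lemma sqn_conj x : sqn x^* = sqn x.
Proof. by case: x => a b; rewrite /sqn /= sqrrN. Qed.

Lemma sqnN x : sqn (- x) = sqn x.
Proof. by case: x => a b; rewrite /sqn /= !sqrrN. Qed.

Lemma normc_real r : normc r%:C = `|r|.
Proof. by rewrite /normc /= expr0n addr0 sqrtr_sqr. Qed.

Lemma normc_conj x : normc x^* = normc x.
Proof. by case: x => a b; rewrite /normc /= sqrrN. Qed.

Lemma mul_conjc x : x * x^* = (sqn x)%:C.
Proof. by case: x => a b; rewrite /sqn; simpc; congr (_ +i* _); ring. Qed.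

Lemma Im_invc x : complex.Im x^-1 = - complex.Im x / sqn x.
Proof. by case: x => a b; rewrite /sqn /= mulNr. Qed.

Lemma le_Im_normc x : `|complex.Im x| <= normc x.
Proof.
by case: x => a b; rewrite /normc /= -sqrtr_sqr ler_wsqrtr // lerDr sqr_ge0.
Qed.

Lemma le_Re_normc x : `|complex.Re x| <= normc x.
Proof.
by case: x => a b; rewrite /normc /= -sqrtr_sqr ler_wsqrtr // lerDl sqr_ge0.
Qed.

Lemma le_normc_sum (I : finType) (f : I -> R[i]) :
  normc (\sum_i f i) <= \sum_i normc (f i).
Proof.
apply: (big_ind2 (fun x r => normc x <= r)) => //; first by rewrite normc0.
move=> x1 r1 x2 r2 h1 h2; exact: le_trans (le_normcD _ _) (lerD h1 h2).
Qed.

Lemma Im_neq0 z : complex.Im z != 0 -> z != 0.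
Proof. by apply: contra => /eqP ->. Qed.

Lemma cauchy_schwarz (I : finType) (a b : I -> R) :
  (\sum_i a i * b i) ^+ 2 <= (\sum_i a i ^+ 2) * (\sum_i b i ^+ 2).
Proof.
(* Lagrange's identity *)
have h : \sum_i \sum_j (a i * b j - a j * b i) ^+ 2 =
    2 * ((\sum_i a i ^+ 2) * (\sum_i b i ^+ 2) - (\sum_i a i * b i) ^+ 2).
  have e1 : (\sum_i a i ^+ 2) * (\sum_i b i ^+ 2) =
      \sum_i \sum_j a i ^+ 2 * b j ^+ 2 by rewrite big_distrlr.
  have e2 : (\sum_i a i ^+ 2) * (\sum_i b i ^+ 2) =
      \sum_i \sum_j a j ^+ 2 * b i ^+ 2 by rewrite e1 exchange_big.
  have e3 : (\sum_i a i * b i) ^+ 2 =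
      \sum_i \sum_j (a i * b i) * (a j * b j) by rewrite expr2 big_distrlr.
  rewrite mulrBr mulr_natl mulr2n {1}e1 e2 e3 mulr_sumr -big_split -sumrB /=.
  apply: eq_bigr => i _; rewrite mulr_sumr -big_split -sumrB /=.
  by apply: eq_bigr => j _; ring.
rewrite -subr_ge0 -(pmulr_rge0 _ (ltr0n R 2)) -h.
by do 2![apply: sumr_ge0 => ? _]; exact: sqr_ge0.
Qed.

(** The square root of each weight and its inverse are inserted into the products. In [den_contract]
    the weights are c_b Im g_b, which turn both factors into sums of the type of [gain]. *)
Lemma cauchy_schwarz_weighted (I : finType) (om : I -> R) (x y : I -> R[i]) :
  (forall i, 0 < om i) ->
  sqn (\sum_i x i * y i) <=
    (\sum_i om i * sqn (x i)) * (\sum_i (om i)^-1 * sqn (y i)).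
Proof.
move=> om_gt0; rewrite sqn_normc.
have sq i : Num.sqrt (om i) != 0 by rewrite gt_eqF // sqrtr_gt0.
pose a i := Num.sqrt (om i) * normc (x i).
pose b i := (Num.sqrt (om i))^-1 * normc (y i).
rewrite (eq_bigr (fun i => a i ^+ 2)) => [|i _]; last first.
  by rewrite exprMn sqr_sqrtr ?ltW // sqn_normc.
rewrite [X in _ * X](eq_bigr (fun i => b i ^+ 2)) => [|i _]; last first.
  by rewrite exprMn exprVn sqr_sqrtr ?ltW // sqn_normc.
apply: le_trans (cauchy_schwarz a b).
rewrite ler_sqr ?nnegrE ?normc_ge0 //; last first.
  by apply: sumr_ge0 => i _; rewrite !mulr_ge0 ?invr_ge0 ?sqrtr_ge0 ?normc_ge0.
apply: le_trans (le_normc_sum _) _; apply: ler_sum => i _.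
by rewrite normcM /a /b mulrACA mulfV // mul1r.
Qed.

End ComplexScalars.

(** * Frobenius norms and factorization of positive semi-definite matrices *)

Section ComplexMatrices.
Variable R : realType.

Definition fro2 m n (X : 'M[R[i]]_(m, n)) : R := \sum_i \sum_j sqn (X i j).

Lemma fro2_ge0 m n (X : 'M[R[i]]_(m, n)) : 0 <= fro2 X.
Proof. by do 2![apply: sumr_ge0 => ? _]; exact: sqn_ge0. Qed.

Lemma fro2_gt0 m n (X : 'M[R[i]]_(m, n)) : X != 0 -> 0 < fro2 X.
Proof.
move=> X0; rewrite lt0r fro2_ge0 andbT; apply: contra X0 => /eqP h.
apply/eqP/matrixP => i j; rewrite mxE; apply/eqP; rewrite -sqn_eq0.
have /psumr_eq0P h1 : forall i, true -> 0 <= \sum_j sqn (X i j).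
  by move=> ? _; apply: sumr_ge0 => ? _; exact: sqn_ge0.
have /psumr_eq0P h2 : forall j, true -> 0 <= sqn (X i j).
  by move=> ? _; exact: sqn_ge0.
by rewrite h2 // h1.
Qed.

Lemma fro2_eq0 m n (X : 'M[R[i]]_(m, n)) : fro2 X = 0 -> X = 0.
Proof. by move=> h; apply/eqP; case: eqP => // /eqP /fro2_gt0; rewrite h ltxx. Qed.

Lemma adjE m n (X : 'M[R[i]]_(m, n)) i j : (X^t* ) i j = (X j i)^*.
Proof. by rewrite !mxE. Qed.

Lemma adjM m n q (X : 'M[R[i]]_(m, n)) (Y : 'M[R[i]]_(n, q)) :
  (X *m Y)^t* = Y^t* *m X^t*.
Proof. by rewrite trmx_mul map_mxM. Qed.

Lemma adjK m n (X : 'M[R[i]]_(m, n)) : X^t*^t* = X.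
Proof. exact: trmxCK. Qed.

Lemma fro2_adj m n (X : 'M[R[i]]_(m, n)) : fro2 (X^t* ) = fro2 X.
Proof.
rewrite /fro2 exchange_big; apply: eq_bigr => i _; apply: eq_bigr => j _.
by rewrite adjE sqn_conj.
Qed.

Lemma tr_mul_adj m n (X : 'M[R[i]]_(m, n)) : \tr (X *m X^t*) = (fro2 X)%:C.
Proof.
rewrite /fro2 rmorph_sum; apply: eq_bigr => i _; rewrite mxE rmorph_sum.
by apply: eq_bigr => j _; rewrite adjE mul_conjc.
Qed.

Lemma tr_adj n (X : 'M[R[i]]_n) : \tr (X^t* ) = (\tr X)^*.
Proof. by rewrite rmorph_sum; apply: eq_bigr => i _; rewrite adjE. Qed.

Lemma tr11 (X : 'M[R[i]]_1) : \tr X = X 0 0.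
Proof. by rewrite /mxtrace big_ord1. Qed.

Lemma le_fro2 m n (X : 'M[R[i]]_(m, n)) i j : sqn (X i j) <= fro2 X.
Proof.
rewrite /fro2 (bigD1 i) //= (bigD1 j) //= -addrA lerDl addr_ge0 //.
  by apply: sumr_ge0 => *; exact: sqn_ge0.
by do 2![apply: sumr_ge0 => ? _]; exact: sqn_ge0.
Qed.

(** In [hermitian_spectral], [H] and [spectral_diag H] occur inside the terms that replace them;
    with variables in their place, each is substituted only once. *)
Lemma unitary_decomposition n (H U V W : 'M[R[i]]_n) (d d' : 'rV[R[i]]_n) :
  H = V *m diag_mx d *m U -> V = W -> d = d' -> H = W *m diag_mx d' *m U.
Proof. by move=> -> -> ->. Qed.

Lemma hermitian_spectral n (H : 'M[R[i]]_n) : H \is hermsymmx ->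
  exists (U : 'M[R[i]]_n) (l : 'I_n -> R),
    [/\ U *m U^t* = 1%:M, U^t* *m U = 1%:M &
        H = U^t* *m diag_mx (\row_j (l j)%:C) *m U].
Proof.
move=> hH; have Uu := spectral_unitarymx H.
exists (spectralmx H), (fun j => complex.Re (spectral_diag H 0 j)).
have e1 : spectralmx H *m (spectralmx H)^t* = 1%:M by exact/unitarymxP.
split => //.
  by rewrite -(invmx_unitary Uu) mulVmx // spectral_unit.
have /orthomx_spectralP e := hermitian_normalmx hH.
have rd : spectral_diag H = \row_j (complex.Re (spectral_diag H 0 j))%:C.
  apply/rowP => j; rewrite mxE; apply/esym/RRe_real.
  exact: (mxOverP (hermitian_spectral_diag_real hH)).
exact: (unitary_decomposition e (invmx_unitary Uu) rd).
Qed.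

(** The form at the j-th eigenvector is the j-th eigenvalue, which is thus nonnegative; B is the
    square root of the diagonal part times U. Such factors turn the traces below into squared
    Frobenius norms. *)
Lemma psdmx_factor n (A : 'M[R[i]]_n) : psdmx A ->
  exists B : 'M[R[i]]_n, A = B^t* *m B.
Proof.
move=> [hA A_ge0]; have [U [l [UUs UsU eA]]] := hermitian_spectral hA.
have l_ge0 j : 0 <= l j.
  have := A_ge0 (U^t* *m delta_mx j 0).
  set e := delta_mx j 0; rewrite adjM adjK eA.
  have -> : e^t* *m U *m (U^t* *m diag_mx (\row_j (l j)%:C) *m U) *m (U^t* *m e)
    = e^t* *m (U *m U^t* ) *m diag_mx (\row_j (l j)%:C) *m (U *m U^t* ) *m e.
    by move: (U^t* ) (e^t* ) (diag_mx _) => W f D; rewrite !mulmxA.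
  rewrite UUs !mulmx1 /e mxE (bigD1 j) //= big1 => [|i /negPf ij]; last first.
    by rewrite [delta_mx _ _ _ _]mxE ij mulr0.
  rewrite addr0 mul_mx_diag !mxE !eqxx /= rmorph1 mul1r mulr1.
  by rewrite ler0c.
exists (diag_mx (\row_j (Num.sqrt (l j))%:C) *m U).
rewrite adjM {1}eA !mulmxA; congr (_ *m _); rewrite -!mulmxA; congr (_ *m _).
rewrite tr_diag_mx map_diag_mx mulmx_diag; congr diag_mx.
apply/rowP => j; rewrite !mxE.
by rewrite [X in X * _]conjc_real -rmorphM -expr2 sqr_sqrtr.
Qed.

End ComplexMatrices.

Lemma mxtrace_rot (F : comNzRingType) m n q (X : 'M[F]_(m, n)) (Y : 'M[F]_(n, q))
    (Z : 'M[F]_(q, m)) : \tr (X *m Y *m Z) = \tr (Y *m (Z *m X)).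
Proof. by rewrite -mulmxA mxtrace_mulC mulmxA. Qed.

Lemma mul2i_sum (R : realType) k (u v : R) (x f : 'I_k -> R) :
  - (2%:R * u%:C * 'i%C) * v%:C + \sum_b - (2%:R * (x b)%:C * 'i%C) * (f b)%:C =
    2%:R * (- (u * v + \sum_b x b * f b))%:C * 'i%C.
Proof.
rewrite realCN realCD realCM realC_sum.
have -> : \sum_b - (2%:R * (x b)%:C * 'i%C) * (f b)%:C =
    - (2%:R * (\sum_b (x b * f b)%:C) * 'i%C) :> R[i].
  rewrite mulr_sumr mulr_suml -sumrN; apply: eq_bigr => b _.
  by rewrite realCM; ring.
by ring.
Qed.

(** * Inverses of x0 I + sum_b x_b C_b *)

Section Pencil.
Variables (R : realType) (k p : nat) (C B : 'I_k -> 'M[R[i]]_p).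
Hypothesis CB : forall b, C b = (B b)^t* *m B b.
Variables (x0 : R[i]) (x : 'I_k -> R[i]).
(** For x0 = 1 this is [resolvent_arg], for x0 = z a multiple of it by z. The second form has a
    positive Im x0, which the invertibility and the bounds below rely on. *)
Let X : 'M[R[i]]_p := x0%:M + \sum_b x b *: C b.

Lemma adj_pencil :
  X^t* = (x0^* )%:M + \sum_b (x b)^* *: C b.
Proof.
rewrite /X linearD /= map_mxD tr_scalar_mx map_scalar_mx; congr (_ + _).
rewrite linear_sum /= map_mx_sum; apply: eq_bigr => b _.
by rewrite linearZ /= map_mxZ CB adjM adjK.
Qed.

Lemma tr_sandwich a b (Y : 'M[R[i]]_p) :
  \tr (C a *m Y *m C b *m Y^t* ) = (fro2 (B a *m Y *m (B b)^t* ))%:C.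
Proof.
rewrite -tr_mul_adj.
have -> : (B a *m Y *m (B b)^t* )^t* = B b *m Y^t* *m (B a)^t*.
  by rewrite adjM adjK adjM mulmxA.
have -> : C a *m Y *m C b *m Y^t* =
    (B a)^t* *m (B a *m Y *m (B b)^t* ) *m (B b *m Y^t* ).
  by rewrite (CB a) (CB b) !mulmxA.
exact: mxtrace_rot.
Qed.

Lemma tr_sandwich0 a (Y : 'M[R[i]]_p) :
  \tr (C a *m Y *m Y^t* ) = (fro2 (B a *m Y))%:C.
Proof. rewrite -tr_mul_adj adjM.
have -> : C a *m Y *m Y^t* = (B a)^t* *m (B a *m Y) *m Y^t*.
  by rewrite (CB a) !mulmxA.
exact: mxtrace_rot. Qed.

(** The source of all sign information: x0 = 1 gives Im tr (C_a Q), and x0 = z gives the sign of Im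
    (z T(g)_a). *)
Lemma Im_tr_inv_pencil (Y : 'M[R[i]]_p) a : Y *m X = 1%:M ->
  complex.Im (\tr (C a *m Y)) =
    - (complex.Im x0 * fro2 (B a *m Y) +
       \sum_b complex.Im (x b) * fro2 (B a *m Y *m (B b)^t* )).
Proof.
move=> YX.
have XY : X^t* *m Y^t* = 1%:M by rewrite -adjM YX trmx1 map_mx1.
(* resolvent identity between Y and its adjoint *)
have e : Y - Y^t* = Y *m (X^t* - X) *m Y^t*.
  by rewrite mulmxBr YX mulmxBl -mulmxA XY mulmx1 mul1mx.
have eD : X^t* - X = (- (2%:R * (complex.Im x0)%:C * 'i%C))%:M +
    \sum_b (- (2%:R * (complex.Im (x b))%:C * 'i%C)) *: C b.
  rewrite adj_pencil /X opprD addrACA -raddfB -sumrB; congr (_%:M + _).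
    by rewrite -subcJ opprB.
  by apply: eq_bigr => b _; rewrite -scalerBl -subcJ opprB.
have := congr1 (fun M => \tr (C a *m M)) e.
rewrite mulmxBr linearB /=.
have -> : \tr (C a *m Y^t* ) = (\tr (C a *m Y))^*.
  by rewrite -tr_adj adjM mxtrace_mulC CB adjM adjK.
rewrite subcJ; set t := \tr (C a *m Y); rewrite eD mulmxDr mulmxDl mulmxDr linearD /= mul_mx_scalar.
rewrite -scalemxAl -scalemxAr linearZ /= (mulmxA (C a) Y) tr_sandwich0.
rewrite mulmx_sumr mulmx_suml mulmx_sumr [\tr (\sum_(i < k) _)]linear_sum /=.
under eq_bigr => b _ do
  rewrite -scalemxAr -scalemxAl -scalemxAr linearZ /= (mulmxA _ _ (Y^t* ))
    (mulmxA _ Y) tr_sandwich.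
move=> h.
apply: complexI.
have two0 : (2%:R : R[i]) != 0 by rewrite pnatr_eq0.
have i0 : ('i%C : R[i]) != 0 by rewrite eq_complex /= oner_eq0 andbF.
apply: (mulfI two0); apply: (mulIf i0); rewrite h.
exact: (mul2i_sum (complex.Im x0) _ (fun b => complex.Im (x b))).
Qed.

Lemma pencil_form (r : 'rV[R[i]]_p) :
  (r *m X *m r^t* ) 0 0 =
    x0 * (fro2 r)%:C + \sum_b x b * (fro2 (r *m (B b)^t* ))%:C.
Proof.
rewrite -tr11 /X mulmxDr mulmxDl linearD /= mul_mx_scalar -scalemxAl linearZ /=.
rewrite tr_mul_adj mulmx_sumr mulmx_suml [\tr (\sum_(i < k) _)]linear_sum /=; congr (_ + _).
apply: eq_bigr => b _; rewrite -scalemxAr -scalemxAl linearZ /=.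
by rewrite -tr_mul_adj adjM adjK CB !mulmxA.
Qed.

Hypothesis x0_gt0 : 0 < complex.Im x0.
Hypothesis x_ge0 : forall b, 0 <= complex.Im (x b).

Lemma Im_pencil_form (r : 'rV[R[i]]_p) :
  complex.Im x0 * fro2 r <= complex.Im ((r *m X *m r^t* ) 0 0).
Proof.
rewrite pencil_form ImD ImZr lerDl Im_sum.
by apply: sumr_ge0 => b _; rewrite ImZr mulr_ge0 ?fro2_ge0.
Qed.

(** If r X = 0, the form at r vanishes, although its imaginary part is at least Im x0 times the
    squared norm of r. *)
Lemma pencil_unit : X \in unitmx.
Proof.
rewrite -row_free_unit; apply: inj_row_free => r rX.
apply: fro2_eq0; apply/eqP; rewrite eq_le fro2_ge0 andbT.
have := Im_pencil_form r; rewrite rX mul0mx mxE /=.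
by rewrite pmulr_rle0.
Qed.

(** Let r be the i-th row of the inverse and y = Im x0. As r X is the i-th basis vector, the form at
    r is the conjugate of r_i, so y |r|^2 <= |r_i| <= |r|, and |r| <= 1 / y. *)
Lemma inv_pencil_entry i j : normc (invmx X i j) <= (complex.Im x0)^-1.
Proof.
set y := complex.Im x0; set r := row i (invmx X).
have y0 : 0 < y := x0_gt0.
have rX : r *m X = delta_mx 0 i by rewrite -row_mul mulVmx ?pencil_unit // row1.
have h : y * fro2 r <= normc (invmx X i i).
  apply: le_trans (Im_pencil_form r) _; rewrite rX -rowE mxE adjE !mxE.
  by rewrite (le_trans (ler_norm _)) // (le_trans (le_Im_normc _)) ?normc_conj.
have hj l : normc (invmx X i l) ^+ 2 <= fro2 r.
  by have := le_fro2 r 0 l; rewrite sqn_normc mxE.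
have hi : normc (invmx X i i) <= y^-1.
  rewrite -(ler_pM2l y0) mulfV ?gt_eqF //.
  have := hj i; have := normc_ge0 (invmx X i i).
  set m := normc _ in h *; move=> m0 hm.
  have [m_eq0|m_neq0] := eqVneq m 0; first by rewrite m_eq0 mulr0 ler01.
  have m_gt0 : 0 < m by rewrite lt0r m_neq0.
  rewrite -(ler_pM2r m_gt0) mul1r -mulrA -expr2; apply: le_trans h.
  by rewrite ler_pM2l.
rewrite -ler_sqr ?nnegrE ?normc_ge0 ?invr_ge0 ?(ltW y0) //.
apply: le_trans (hj j) _; rewrite -(ler_pM2l y0) expr2 mulrA mulfV ?gt_eqF //.
by rewrite mul1r (le_trans h).
Qed.

End Pencil.

(** With r = c0, d = [den z g a] and u = Im z + [gain g a], the factor u / (r |d|^2) is Im T(g)_a,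
    and likewise for e and v with h. A bound on differences of [den] thus becomes one on differences
    of T. *)
Lemma sqn_inv_sub_le (R : realType) (d e : R[i]) (r s u v : R) :
  r%:C != 0 :> R[i] -> d != 0 -> e != 0 -> sqn (d - e) <= s * (u * v) ->
  sqn ((r%:C * d)^-1 - (r%:C * e)^-1) <=
    s * (r^-1 * u / sqn d * (r^-1 * v / sqn e)).
Proof.
move=> r0 d0 e0 h.
have -> : (r%:C * d)^-1 - (r%:C * e)^-1 = (r%:C)^-1 * ((e - d) / (d * e)).
  by field; rewrite d0 e0 r0.
have -> : s * (r^-1 * u / sqn d * (r^-1 * v / sqn e)) =
    r^-1 ^+ 2 * (s * (u * v) / (sqn d * sqn e)) by rewrite invfM; ring.
rewrite sqnM realCV sqn_real sqnM sqnV sqnM -sqnN opprB.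
apply: ler_wpM2l; first exact: sqr_ge0.
by apply: ler_wpM2r h; rewrite invr_ge0 mulr_ge0 ?sqn_ge0.
Qed.

(** * The fixed-point map *)

Section Iteration.
Variables (R : realType) (k n p : nat) (ns : 'I_k -> nat).
Variables C B : 'I_k -> 'M[R[i]]_p.
Hypothesis CB : forall b, C b = (B b)^t* *m B b.
Hypotheses (n_gt0 : (0 < n)%N) (p_gt0 : (0 < p)%N).
Hypothesis ns_gt0 : forall a, (0 < ns a)%N.

Local Notation c0 := (dim_ratio R n p).
Local Notation c := (class_ratio R n ns).
Local Notation arg := (resolvent_arg n ns C).
Implicit Types (z : R[i]) (g h : 'rV[R[i]]_k) (a b : 'I_k).

Lemma dim_ratio_gt0 : 0 < c0.
Proof. by rewrite divr_gt0 ?ltr0n. Qed.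

Lemma class_ratio_gt0 b : 0 < c b.
Proof. by rewrite divr_gt0 ?ltr0n. Qed.

Let p_inv_gt0 : 0 < (p%:R^-1 : R).
Proof. by rewrite invr_gt0 ltr0n. Qed.

Let p_invC : (p%:R^-1 : R[i]) = (p%:R^-1)%:C.
Proof. by rewrite natrC realCV. Qed.

(* This is - z (1 + gtilde_a), so that the system reads g = fixmap z g. *)
Definition den z g a : R[i] := - z + p%:R^-1 * \tr (C a *m invmx (arg g)).

Definition fixmap z g : 'rV[R[i]]_k := \row_a (c0%:C * den z g a)^-1.

(* The inequalities are not strict, so that the domain is closed under limits. *)
Definition half_plane_dom z g :=
  forall b, 0 <= complex.Im (g 0 b) /\ 0 <= complex.Im (z * g 0 b).

(* - (1/p) Im tr (C_a Q), hence Im (den z g a) = - (Im z + gain g a) *)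
Definition gain g a : R :=
  p%:R^-1 * \sum_b c b * complex.Im (g 0 b) *
    fro2 (B a *m invmx (arg g) *m (B b)^t* ).

(** A crude size of the C_a; what matters is that it depends on neither z nor g. *)
Definition entry_sum : R := \sum_a \sum_i \sum_j normc (C a i j).

Lemma entry_sum_ge0 : 0 <= entry_sum.
Proof. by do 3![apply: sumr_ge0 => ? _]; exact: normc_ge0. Qed.

Lemma normc_tr_le a (Y : 'M[R[i]]_p) (e : R) : 0 <= e ->
  (forall i j, normc (Y i j) <= e) -> normc (\tr (C a *m Y)) <= entry_sum * e.
Proof.
move=> e0 Ye; rewrite /entry_sum mulr_suml (bigD1 a) //=.
rewrite -[X in X <= _]addr0 lerD //; last first.
  apply: sumr_ge0 => b _; rewrite mulr_ge0 //.
  by do 2![apply: sumr_ge0 => ? _]; exact: normc_ge0.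
apply: le_trans (le_normc_sum _) _; rewrite mulr_suml.
apply: ler_sum => i _; rewrite mxE; apply: le_trans (le_normc_sum _) _.
rewrite mulr_suml; apply: ler_sum => j _; rewrite normcM.
by rewrite ler_wpM2l ?normc_ge0.
Qed.

(** Multiplication by z makes the scalar term non-real, and the second condition of [half_plane_dom]
    says that the other coefficients have nonnegative imaginary part. The pencil estimates then
    apply. *)
Lemma scale_arg z g :
  z *: arg g = z%:M + \sum_b ((c b)%:C * (z * g 0 b)) *: C b.
Proof.
rewrite /resolvent_arg scalerDr scale_scalar_mx mulr1 scaler_sumr.
congr (_ + _); apply: eq_bigr => b _; rewrite scalerA; congr (_ *: _).
by rewrite mulrCA.
Qed.

Section UpperHalfPlane.
Variables (z : R[i]).
Hypothesis z_gt0 : 0 < complex.Im z.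

Let z_neq0 : z != 0.
Proof. by apply: Im_neq0; rewrite gt_eqF. Qed.

Section Dom.
Variable g : 'rV[R[i]]_k.
Hypothesis g_dom : half_plane_dom z g.

Let Im_ge0 b : 0 <= complex.Im ((c b)%:C * (z * g 0 b)).
Proof. by rewrite ImZ mulr_ge0 ?(ltW (class_ratio_gt0 b)) //; case: (g_dom b). Qed.

Lemma scaled_arg_unit : z *: arg g \in unitmx.
Proof. by rewrite scale_arg (pencil_unit CB). Qed.

Lemma arg_unit : arg g \in unitmx.
Proof. by have := scaled_arg_unit; rewrite unitmxZ ?unitfE. Qed.

Lemma inv_scaled_arg : invmx (z *: arg g) = z^-1 *: invmx (arg g).
Proof. by rewrite invmxZ ?scaled_arg_unit // unitfE. Qed.

Lemma inv_arg_entry i j : normc (invmx (arg g) i j) <= normc z / complex.Im z.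
Proof.
have := @inv_pencil_entry _ _ _ _ _ CB z _ z_gt0 Im_ge0 i j.
rewrite -scale_arg inv_scaled_arg mxE normcM normcV mulrC.
by rewrite ler_pdivrMr ?lt0r ?normc_ge0 ?normc_eq0 ?z_neq0 // mulrC.
Qed.

Lemma normc_tr_inv_arg a :
  normc (\tr (C a *m invmx (arg g))) <= entry_sum * (normc z / complex.Im z).
Proof.
apply: normc_tr_le inv_arg_entry.
by rewrite divr_ge0 ?normc_ge0 ?(ltW z_gt0).
Qed.

Lemma Im_tr_inv_arg a : complex.Im (\tr (C a *m invmx (arg g))) =
  - \sum_b c b * complex.Im (g 0 b) *
    fro2 (B a *m invmx (arg g) *m (B b)^t* ).
Proof.
rewrite (Im_tr_inv_pencil CB a (mulVmx arg_unit)) /= mul0r add0r.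
by congr (- _); apply: eq_bigr => b _; rewrite ImZ.
Qed.

Lemma gainE a : gain g a = - (p%:R^-1 * complex.Im (\tr (C a *m invmx (arg g)))).
Proof. by rewrite Im_tr_inv_arg mulrN opprK. Qed.

(** The formula for Im tr (C_a Q) is applied to the adjoint of Q, the inverse of the conjugate
    pencil. Trace and coefficients both change sign, and a and b trade places in the norms.
    Cauchy-Schwarz in [den_contract] yields one form for g and the other for h. *)
Lemma gain_swap a : gain g a =
  p%:R^-1 * \sum_b c b * complex.Im (g 0 b) *
    fro2 (B b *m invmx (arg g) *m (B a)^t* ).
Proof.
rewrite gainE; set Q := invmx _.
have QX : Q^t* *m ((1 : R[i])%:M + \sum_b ((c b)%:C * (g 0 b)^* ) *: C b) = 1%:M.
  have -> : (1 : R[i])%:M + \sum_b ((c b)%:C * (g 0 b)^* ) *: C b = (arg g)^t*.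
    rewrite /resolvent_arg (adj_pencil CB 1); congr (_ + _).
      by congr (_%:M); exact: esym (conjc1 R).
    apply: eq_bigr => b _; congr (_ *: _).
    by rewrite [in RHS]rmorphM; congr (_ * _); exact: esym (conjc_real _).
  by rewrite -adjM mulmxV ?arg_unit // trmx1 map_mx1.
have := Im_tr_inv_pencil CB a QX.
have -> : \tr (C a *m Q^t* ) = (\tr (C a *m Q))^*.
  by rewrite -tr_adj adjM mxtrace_mulC CB adjM adjK.
rewrite Im_conjc mul0r add0r => /oppr_inj ->.
rewrite -mulrN -sumrN; congr (_ * _); apply: eq_bigr => b _.
rewrite ImZ Im_Num_conj mulrN mulNr opprK; congr (_ * _).
by rewrite -[in RHS]fro2_adj !adjM adjK mulmxA.
Qed.

Lemma gain_ge0 a : 0 <= gain g a.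
Proof.
rewrite mulr_ge0 ?(ltW p_inv_gt0) //; apply: sumr_ge0 => b _.
by rewrite !mulr_ge0 ?fro2_ge0 ?(ltW (class_ratio_gt0 b)) //; case: (g_dom b).
Qed.

(** Independent of g, so that the contraction factor [rate] is uniform on the domain. *)
Definition gain_bound : R := p%:R^-1 * (entry_sum * (normc z / complex.Im z)).

Lemma gain_bound_ge0 : 0 <= gain_bound.
Proof.
rewrite mulr_ge0 ?(ltW p_inv_gt0) // mulr_ge0 ?entry_sum_ge0 //.
by rewrite divr_ge0 ?normc_ge0 ?(ltW z_gt0).
Qed.

Lemma gain_le a : gain g a <= gain_bound.
Proof.
rewrite gainE -mulrN ler_wpM2l ?(ltW p_inv_gt0) //.
apply: le_trans (normc_tr_inv_arg a); apply: le_trans (le_Im_normc _).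
by rewrite -normrN ler_norm.
Qed.

Lemma Im_den a : complex.Im (den z g a) = - (complex.Im z + gain g a).
Proof. by rewrite /den ImD ImN p_invC ImZ gainE opprD opprK. Qed.

Lemma Im_den_lt0 a : complex.Im (den z g a) < 0.
Proof. by rewrite Im_den oppr_lt0 ltr_pwDl // gain_ge0. Qed.

Lemma den_neq0 a : den z g a != 0.
Proof. by apply: Im_neq0; rewrite lt_eqF // Im_den_lt0. Qed.

Lemma normc_den_ge a : complex.Im z <= normc (den z g a).
Proof.
apply: le_trans (le_Im_normc _); rewrite Im_den normrN ger0_norm.
  by rewrite lerDl gain_ge0.
by rewrite addr_ge0 ?gain_ge0 // ltW.
Qed.

Lemma normc_den_le a : normc (den z g a) <= normc z + gain_bound.
Proof.
apply: le_trans (le_normcD _ _) _; rewrite normcN lerD2l normcM p_invC.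
by rewrite normc_real gtr0_norm // ler_wpM2l ?(ltW p_inv_gt0) ?normc_tr_inv_arg.
Qed.

Lemma normc_fixmap a : c0 * normc (fixmap z g 0 a) <= (complex.Im z)^-1.
Proof.
rewrite mxE normcV normcM normc_real (gtr0_norm dim_ratio_gt0) invfM mulrA.
rewrite mulfV ?gt_eqF ?dim_ratio_gt0 // mul1r lef_pV2 ?normc_den_ge //.
by rewrite posrE (lt_le_trans z_gt0) ?normc_den_ge.
Qed.

Lemma Im_fixmap a : complex.Im (fixmap z g 0 a) =
  c0^-1 * (complex.Im z + gain g a) / sqn (den z g a).
Proof.
by rewrite mxE invfM realCV ImZ Im_invc Im_den opprK mulrA.
Qed.

(** Independent of g: limits of iterates keep a positive imaginary part, and the denominators in the
    contracted quantity stay away from 0. *)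
Definition fixmap_lower : R :=
  c0^-1 * complex.Im z / (normc z + gain_bound) ^+ 2.

Lemma fixmap_lower_gt0 : 0 < fixmap_lower.
Proof.
rewrite /fixmap_lower !mulr_gt0 ?invr_gt0 ?dim_ratio_gt0 ?exprn_gt0 //.
by rewrite ltr_pwDl ?gain_bound_ge0 // lt0r normc_ge0 normc_eq0 z_neq0.
Qed.

Lemma Im_fixmap_ge a : fixmap_lower <= complex.Im (fixmap z g 0 a).
Proof.
rewrite Im_fixmap /fixmap_lower ler_pM //.
- by rewrite mulr_ge0 ?invr_ge0 ?(ltW dim_ratio_gt0) ?(ltW z_gt0).
- by rewrite invr_ge0 sqr_ge0.
- by rewrite ler_wpM2l ?invr_ge0 ?(ltW dim_ratio_gt0) // lerDl gain_ge0.
- rewrite lef_pV2 ?posrE ?sqn_gt0 ?den_neq0 //.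
    by rewrite sqn_normc lerXn2r ?nnegrE ?normc_ge0 ?normc_den_le //
      addr_ge0 ?normc_ge0 ?gain_bound_ge0.
  by rewrite exprn_gt0 // (lt_le_trans _ (normc_den_le a)) //
    lt0r normc_ge0 normc_eq0 den_neq0.
Qed.

Lemma Im_fixmap_gt0 a : 0 < complex.Im (fixmap z g 0 a).
Proof. exact: lt_le_trans fixmap_lower_gt0 (Im_fixmap_ge a). Qed.

(** Here z T(g)_a is the inverse of c0 [den] / z, and [den] / z = - 1 + (1/p) tr (C_a Y) with Y the
    inverse of z [arg g]; the pencil formula applies with x0 = z. *)
Lemma Im_z_fixmap a : complex.Im (z * fixmap z g 0 a) =
  p%:R^-1 * c0^-1 / sqn (den z g a / z) *
  (complex.Im z * fro2 (B a *m invmx (z *: arg g)) +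
    \sum_b c b * complex.Im (z * g 0 b) *
      fro2 (B a *m invmx (z *: arg g) *m (B b)^t* )).
Proof.
have -> : z * fixmap z g 0 a = (c0^-1)%:C * (den z g a / z)^-1.
  by rewrite mxE invfM realCV mulrCA [(den z g a / z)^-1]invfM invrK [z * _]mulrC.
rewrite ImZ Im_invc.
have -> : den z g a / z = -1 + (p%:R^-1)%:C * \tr (C a *m invmx (z *: arg g)).
  rewrite inv_scaled_arg -scalemxAr linearZ /= /den mulrDl mulNr mulfV //.
  by rewrite p_invC -mulrA [_ * z^-1]mulrC.
set t := sqn _; rewrite ImD ImN /= oppr0 add0r ImZ.
have h := mulVmx scaled_arg_unit; rewrite {2}scale_arg in h.
rewrite (Im_tr_inv_pencil CB a h).
have -> : \sum_b complex.Im ((c b)%:C * (z * g 0 b)) *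
     fro2 (B a *m invmx (z *: arg g) *m (B b) ^t*) =
  \sum_b c b * complex.Im (z * g 0 b) *
     fro2 (B a *m invmx (z *: arg g) *m (B b) ^t*).
  by apply: eq_bigr => b _; rewrite ImZ.
by ring.
Qed.

Let z_fixmap_coef_gt0 a : 0 < p%:R^-1 * c0^-1 / sqn (den z g a / z).
Proof.
rewrite divr_gt0 ?mulr_gt0 ?invr_gt0 ?dim_ratio_gt0 ?ltr0n //.
by rewrite sqn_gt0 mulf_neq0 ?invr_eq0 ?den_neq0.
Qed.

Let z_fixmap_sum_ge0 a : 0 <= \sum_b c b * complex.Im (z * g 0 b) *
      fro2 (B a *m invmx (z *: arg g) *m (B b)^t* ).
Proof.
apply: sumr_ge0 => b _; rewrite !mulr_ge0 ?fro2_ge0 ?(ltW (class_ratio_gt0 b)) //.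
by case: (g_dom b).
Qed.

Lemma Im_z_fixmap_ge0 a : 0 <= complex.Im (z * fixmap z g 0 a).
Proof.
rewrite Im_z_fixmap mulr_ge0 ?(ltW (z_fixmap_coef_gt0 a)) //.
by rewrite addr_ge0 // mulr_ge0 ?fro2_ge0 ?(ltW z_gt0).
Qed.

(** The first term in [Im_z_fixmap] vanishes only if B_a = 0. For C_a = 0, z T(g)_a is the real
    number - 1 / c0, so strictness fails there. *)
Lemma Im_z_fixmap_gt0 a : C a != 0 -> 0 < complex.Im (z * fixmap z g 0 a).
Proof.
move=> Ca0; rewrite Im_z_fixmap mulr_gt0 // ltr_wpDr // mulr_gt0 //.
apply: fro2_gt0; apply: contra Ca0 => /eqP h.
rewrite CB -[B a](mulmxK scaled_arg_unit) -[B a *m _ *m _]mulmxA.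
have -> : B a = 0.
  have := congr1 (mulmx^~ (z *: arg g)) h.
  by rewrite mul0mx -mulmxA mulVmx ?scaled_arg_unit // mulmx1.
by rewrite mul0mx mulmx0.
Qed.

Lemma fixmap_dom : half_plane_dom z (fixmap z g).
Proof. by move=> a; rewrite (ltW (Im_fixmap_gt0 a)) Im_z_fixmap_ge0. Qed.

End Dom.

(** With Q and Q' the two inverses, Q - Q' = - Q (arg g - arg h) Q'. The trace is spread into a
    single sum over b and the matrix indices i, j, ready for Cauchy-Schwarz. *)
Lemma den_sub g h a : half_plane_dom z g -> half_plane_dom z h ->
  den z g a - den z h a =
   - (p%:R^-1)%:C * \sum_(s : 'I_k * ('I_p * 'I_p))
     (B a *m invmx (arg g) *m (B s.1)^t* ) s.2.1 s.2.2 *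
     ((c s.1)%:C * (g 0 s.1 - h 0 s.1) *
       (B s.1 *m invmx (arg h) *m (B a)^t* ) s.2.2 s.2.1).
Proof.
move=> g_dom h_dom; have ug := arg_unit g_dom; have uh := arg_unit h_dom.
set Q := invmx (arg g); set Q' := invmx (arg h).
have QQ : Q - Q' = - \sum_b ((c b)%:C * (g 0 b - h 0 b)) *: (Q *m C b *m Q').
  have -> : Q - Q' = - (Q *m (arg g - arg h) *m Q').
    rewrite mulmxBr mulmxBl mulVmx // mul1mx -mulmxA mulmxV // mulmx1.
    by rewrite opprB.
  rewrite /resolvent_arg opprD addrACA subrr add0r -sumrB mulmx_sumr mulmx_suml.
  congr (- _); apply: eq_bigr => b _.
  by rewrite -scalerBl -mulrBr -scalemxAr -scalemxAl.
rewrite /den opprD addrACA subrr add0r -mulrBr -linearB /= -mulmxBr QQ p_invC.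
rewrite mulNr -mulrN; congr (_ * _); rewrite mulmxN linearN /=; congr (- _).
rewrite mulmx_sumr linear_sum /=.
rewrite -(pair_bigA _ (fun b (ij : 'I_p * 'I_p) =>
   (B a *m Q *m (B b)^t* ) ij.1 ij.2 * ((c b)%:C * (g 0 b - h 0 b) *
      (B b *m Q' *m (B a)^t* ) ij.2 ij.1))) /=.
apply: eq_bigr => b _; rewrite -scalemxAr linearZ /=.
have -> : \tr (C a *m (Q *m C b *m Q')) =
    \tr ((B a *m Q *m (B b)^t* ) *m (B b *m Q' *m (B a)^t* )).
  have -> : C a *m (Q *m C b *m Q') =
      (B a)^t* *m (B a *m Q *m (B b)^t* ) *m (B b *m Q').
    by rewrite (CB a) (CB b) !mulmxA.
  exact: mxtrace_rot.
rewrite -(pair_bigA _ (fun i j => (B a *m Q *m (B b)^t* ) i j *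
  ((c b)%:C * (g 0 b - h 0 b) * (B b *m Q' *m (B a)^t* ) j i))) /=.
rewrite [\tr _]/mxtrace mulr_sumr; apply: eq_bigr => i _.
by rewrite mxE mulr_sumr; apply: eq_bigr => j _; rewrite mulrCA.
Qed.

(** Weighted Cauchy-Schwarz is applied to [den_sub] with weights c_b Im g_b. The first factor is p
    [gain g a]; by the assumed bound on |g_b - h_b|^2, the second is at most tau p [gain h a], in
    the form of [gain_swap]. *)
Lemma den_contract g h (tau : R) a :
  half_plane_dom z g -> half_plane_dom z h -> 0 <= tau ->
  (forall b, 0 < complex.Im (g 0 b)) ->
  (forall b, sqn (g 0 b - h 0 b) <=
     tau * (complex.Im (g 0 b) * complex.Im (h 0 b))) ->
  sqn (den z g a - den z h a) <= tau * (gain g a * gain h a).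
Proof.
move=> g_dom h_dom tau0 g_gt0 dist.
rewrite (den_sub a g_dom h_dom) -[- (p%:R^-1)%:C]rmorphN sqnM sqn_real sqrrN.
pose om (s : 'I_k * ('I_p * 'I_p)) := c s.1 * complex.Im (g 0 s.1).
have om_gt0 s : 0 < om s by rewrite mulr_gt0 ?class_ratio_gt0.
have := cauchy_schwarz_weighted
  (fun s => (B a *m invmx (arg g) *m (B s.1)^t* ) s.2.1 s.2.2)
  (fun s => (c s.1)%:C * (g 0 s.1 - h 0 s.1) *
       (B s.1 *m invmx (arg h) *m (B a)^t* ) s.2.2 s.2.1) om_gt0.
move=> /(ler_wpM2l (sqr_ge0 (p%:R^-1 : R))) /le_trans; apply.
have e (u s t : R) : tau * (u * s * (u * t)) = u ^+ 2 * (s * (tau * t)) by ring.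
rewrite {1}/gain (gain_swap h_dom) e.
apply: ler_wpM2l; first exact: sqr_ge0.
apply: ler_pM.
- by apply: sumr_ge0 => s _; rewrite mulr_ge0 ?sqn_ge0 // ltW.
- by apply: sumr_ge0 => s _; rewrite mulr_ge0 ?sqn_ge0 // invr_ge0 ltW.
- rewrite -(pair_bigA _ (fun b (ij : 'I_p * 'I_p) => c b * complex.Im (g 0 b) *
     sqn ((B a *m invmx (arg g) *m (B b)^t* ) ij.1 ij.2))) /=.
  apply: ler_sum => b _; rewrite -mulr_sumr /fro2.
  by rewrite (pair_bigA _ (fun i j => sqn ((B a *m invmx (arg g) *m (B b)^t* ) i j))).
- rewrite -(pair_bigA _ (fun b (ij : 'I_p * 'I_p) => (om (b, ij))^-1 *
     sqn ((c b)%:C * (g 0 b - h 0 b) *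
       (B b *m invmx (arg h) *m (B a)^t* ) ij.2 ij.1))) /=.
  rewrite mulr_sumr; apply: ler_sum => b _; rewrite /om /=.
  rewrite mulrA /fro2 exchange_big /= pair_bigA /= mulr_sumr.
  apply: ler_sum => -[i j] _ /=; rewrite !sqnM.
  rewrite [X in X <= _]mulrA; apply: ler_wpM2r; first exact: sqn_ge0.
  rewrite sqn_real invfM.
  have cb := class_ratio_gt0 b; have gb := g_gt0 b.
  rewrite [X in X <= _](_ : _ = c b * (complex.Im (g 0 b))^-1 * sqn (g 0 b - h 0 b)); last first.
    by field; rewrite !gt_eqF.
  rewrite mulrCA -mulrA ler_pM2l // ler_pdivrMl //.
  by rewrite mulrCA.
Qed.

(** The ratio x / (Im z + x) increases with x >= 0; this is its value at the largest possible
    gain. *)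
Definition rate : R := gain_bound / (complex.Im z + gain_bound).

Lemma rate_ge0 : 0 <= rate.
Proof. by rewrite divr_ge0 ?addr_ge0 ?gain_bound_ge0 // ltW. Qed.

Lemma rate_lt1 : rate < 1.
Proof. by rewrite ltr_pdivrMr ?mul1r ?ltrDr // ltr_pwDl ?gain_bound_ge0. Qed.

Lemma gain_rate g a : half_plane_dom z g ->
  gain g a <= rate * (complex.Im z + gain g a).
Proof.
move=> g_dom; have b0 := gain_bound_ge0; have h := gain_le g_dom a.
rewrite /rate mulrAC ler_pdivlMr ?ltr_pwDl //.
rewrite mulrDr mulrDr [gain_bound * gain _ _]mulrC lerD2r.
by rewrite mulrC [X in _ <= X]mulrC ler_pM2l.
Qed.

(* Where [Im g] and [Im h] are positive, the map contracts the quantity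
   max_b |g_b - h_b|^2 / (Im g_b Im h_b) by the factor [rate ^+ 2]. *)
Lemma fixmap_contract g h (tau : R) :
  half_plane_dom z g -> half_plane_dom z h -> 0 <= tau ->
  (forall b, 0 < complex.Im (g 0 b)) ->
  (forall b, sqn (g 0 b - h 0 b) <=
     tau * (complex.Im (g 0 b) * complex.Im (h 0 b))) ->
  forall a, sqn (fixmap z g 0 a - fixmap z h 0 a) <=
    rate ^+ 2 * tau * (complex.Im (fixmap z g 0 a) * complex.Im (fixmap z h 0 a)).
Proof.
move=> g_dom h_dom tau0 g_gt0 dist a.
have dg := den_neq0 g_dom a; have dh := den_neq0 h_dom a.
have c0_gt0 := dim_ratio_gt0.
have c0C : (c0%:C : R[i]) != 0 by rewrite (fmorph_eq0 (real_complex R)) gt_eqF.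
rewrite (Im_fixmap g_dom a) (Im_fixmap h_dom a).
rewrite [fixmap z g 0 a]mxE [fixmap z h 0 a]mxE.
have h1 := den_contract a g_dom h_dom tau0 g_gt0 dist.
have h2 : gain g a * gain h a <=
  rate ^+ 2 * ((complex.Im z + gain g a) * (complex.Im z + gain h a)).
  by rewrite expr2 [X in _ <= X]mulrACA; apply: ler_pM; rewrite ?gain_ge0 ?gain_rate.
apply: sqn_inv_sub_le c0C dg dh _.
by rewrite mulrAC mulrC; exact: le_trans h1 (ler_wpM2l tau0 h2).
Qed.

End UpperHalfPlane.
End Iteration.

(** * The iterates as Stieltjes transforms of finitely supported laws *)

Section Realization.
Variable R : realType.
Implicit Types (z : R[i]).

Definition stieltjes_sum m (w l : 'I_m -> R) z : R[i] :=
  \sum_j (w j)%:C / ((l j)%:C - z).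

Lemma real_sub_neq0 (r : R) z : complex.Im z != 0 -> r%:C - z != 0.
Proof. by move=> z0; apply: Im_neq0; rewrite ImD ImN /= add0r oppr_eq0. Qed.

Lemma diag_resolvent m (l : 'I_m -> R) z : complex.Im z != 0 ->
  (diag_mx (\row_j (l j)%:C) - z%:M) *m
    diag_mx (\row_j ((l j)%:C - z)^-1) = 1%:M.
Proof.
move=> z0; rewrite -diag_const_mx -raddfB mulmx_diag -diag_const_mx.
by congr diag_mx; apply/rowP => j; rewrite !mxE mulfV // real_sub_neq0.
Qed.

Lemma unitary_resolvent m (U : 'M[R[i]]_m) (l : 'I_m -> R) z :
  U *m U^t* = 1%:M -> U^t* *m U = 1%:M -> complex.Im z != 0 ->
  (U^t* *m diag_mx (\row_j (l j)%:C) *m U - z%:M) *m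
    (U^t* *m diag_mx (\row_j ((l j)%:C - z)^-1) *m U) = 1%:M.
Proof.
move=> UUs UsU z0.
have -> : z%:M = U^t* *m z%:M *m U by rewrite mul_mx_scalar -scalemxAl UsU scalemx1.
rewrite -mulmxBl -mulmxBr.
set D := _ - _; set E := diag_mx _.
have -> : U^t* *m D *m U *m (U^t* *m E *m U) = U^t* *m (D *m (U *m U^t* ) *m E) *m U.
  by rewrite !mulmxA.
by rewrite UUs mulmx1 diag_resolvent // mulmx1 UsU.
Qed.

Lemma invmx_unique (F : fieldType) m (X Y : 'M[F]_m) :
  X *m Y = 1%:M -> invmx X = Y.
Proof. by move=> h; have [u _] := mulmx1_unit h; rewrite -[Y](mulKmx u) h mulmx1. Qed.

(** Since (E + V W) G = 1, the product V W G is 1 - E G; after this substitution the cross terms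
    cancel. *)
Lemma woodbury (F : fieldType) m p (E G : 'M[F]_m) (V : 'M[F]_(m, p))
    (W : 'M[F]_(p, m)) :
  E \in unitmx -> (E + V *m W) *m G = 1%:M ->
  (1%:M + W *m invmx E *m V) *m (1%:M - W *m G *m V) = 1%:M.
Proof.
move=> Eu EG; rewrite mulmxDl mul1mx mulmxBr mulmx1.
have -> : W *m invmx E *m V *m (W *m G *m V) =
    W *m invmx E *m (V *m W *m G) *m V by rewrite !mulmxA.
have -> : V *m W *m G = 1%:M - E *m G.
  by apply/esym/eqP; rewrite subr_eq addrC -mulmxDl EG.
have -> : W *m invmx E *m (1%:M - E *m G) *m V =
    W *m invmx E *m V - W *m G *m V.
  rewrite mulmxBr mulmx1 mulmxBl; congr (_ - _ *m _).
  by rewrite -mulmxA (mulmxA (invmx E)) mulVmx // mul1mx.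
by rewrite subKr subrK.
Qed.

Lemma tr_adj_diag m p (W : 'M[R[i]]_(m, p)) (d : 'I_m -> R[i]) :
  \tr (W^t* *m diag_mx (\row_j d j) *m W) =
    \sum_j (\sum_i sqn (W j i))%:C * d j.
Proof.
rewrite mxtrace_rot /mxtrace; rewrite mul_diag_mx; apply: eq_bigr => j _.
rewrite !mxE mulrC realC_sum; congr (_ * _); apply: eq_bigr => i _.
by rewrite adjE mul_conjc.
Qed.

Lemma tr_inv_realization p m (B : 'M[R[i]]_p) (V : 'M[R[i]]_(m, p)) (d : 'I_m -> R) :
  exists mu u : 'I_m -> R, (forall j, 0 <= u j) /\
    forall z, complex.Im z != 0 ->
      \tr (B^t* *m B *m
        invmx (1%:M + V^t* *m diag_mx (\row_j ((d j)%:C - z)^-1) *m V)) =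
      (fro2 B)%:C - stieltjes_sum u mu z.
Proof.
(* the poles are the eigenvalues of D + V V^*, by Woodbury's formula *)
pose D := diag_mx (\row_j (d j)%:C).
have hH : D + V *m V^t* \is hermsymmx.
  apply/is_hermitianmxP; rewrite expr0 scale1r linearD /= map_mxD.
  rewrite tr_diag_mx map_diag_mx [X in _ = _ + X]adjM adjK.
  congr (diag_mx _ + _); apply/rowP => j; rewrite !mxE.
  exact: esym (conjc_real _).
have [U [mu [UUs UsU eH]]] := hermitian_spectral hH.
(* With G the resolvent of D + V V^t*, diagonalized by U, the trace of B^t* B V^t* G V is a
   combination of the 1 / (mu_j - z) whose weights are the squared norms of the rows of U V B^t*. *)
exists mu, (fun j => \sum_i sqn ((U *m V *m B^t* ) j i)); split.
  by move=> j; apply: sumr_ge0 => i _; exact: sqn_ge0.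
move=> z z0.
have hr := unitary_resolvent mu UUs UsU z0; rewrite -eH in hr.
set G := U^t* *m _ *m U in hr.
have hE := diag_resolvent d z0; rewrite -/D in hE.
have Eu : D - z%:M \in unitmx by case: (mulmx1_unit hE).
have Ei : diag_mx (\row_j ((d j)%:C - z)^-1) = invmx (D - z%:M).
  exact/esym/invmx_unique.
rewrite addrAC in hr.
have hw := woodbury Eu hr; rewrite -Ei in hw.
rewrite (invmx_unique hw).
rewrite mulmxBr mulmx1 linearB /=; congr (_ - _).
  by rewrite mxtrace_mulC tr_mul_adj.
have -> : B^t* *m B *m (V^t* *m G *m V) =
    B^t* *m ((B *m (V^t* *m U^t* )) *m diag_mx (\row_j ((mu j)%:C - z)^-1)) *m
      (U *m V).
  by rewrite /G !mulmxA.
rewrite mxtrace_rot.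
have -> : B *m (V^t* *m U^t* ) = (U *m V *m B^t* )^t* by rewrite !adjM adjK.
by rewrite tr_adj_diag.
Qed.

Lemma arrowhead_realization (h : R) m (u mu : 'I_m -> R) :
  (forall j, 0 <= u j) ->
  exists w l : 'I_(1 + m) -> R,
    [/\ forall j, 0 <= w j, \sum_j w j = 1 &
      forall z, complex.Im z != 0 ->
        (h%:C - z - stieltjes_sum u mu z) * stieltjes_sum w l z = 1].
Proof.
(* the law is the spectral measure, at the first basis vector, of the matrix
   [[h, sqrt u], [sqrt u, diag mu]] *)
move=> u_ge0.
pose r : 'rV[R[i]]_m := \row_j (Num.sqrt (u j))%:C.
pose H : 'M[R[i]]_(1 + m) :=
  block_mx (h%:C)%:M r r^T (diag_mx (\row_j (mu j)%:C)).
have rC : map_mx Num.conj r = r.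
  by apply/rowP => j; rewrite !mxE; exact: conjc_real.
have hH : H \is hermsymmx.
  apply/is_hermitianmxP; rewrite expr0 scale1r /H tr_block_mx map_block_mx.
  rewrite trmxK tr_scalar_mx map_scalar_mx tr_diag_mx map_diag_mx.
  rewrite rC -map_trmx rC; congr block_mx.
    by congr (_%:M); exact: esym (conjc_real _).
  by congr diag_mx; apply/rowP => j; rewrite !mxE; exact: esym (conjc_real _).
have [U [l [UUs UsU eH]]] := hermitian_spectral hH.
pose o : 'I_(1 + m) := lshift m 0.
exists (fun j => sqn (U j o)), l; split.
- by move=> j; exact: sqn_ge0.
- apply: complexI; rewrite realC_sum.
  have := congr1 (fun M : 'M[R[i]]_(1 + m) => M o o) UsU.
  rewrite mxE [RHS]mxE eqxx mulr1n => e; rewrite [RHS]rmorph1 -e.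
  apply: eq_bigr => j _.
  by rewrite adjE mulrC mul_conjc.
move=> z z0.
have hr := unitary_resolvent l UUs UsU z0; rewrite -eH in hr.
set G := U^t* *m _ *m U in hr.
have Goo : G o o = stieltjes_sum (fun j => sqn (U j o)) l z.
  rewrite /G mul_mx_diag mxE; apply: eq_bigr => j _.
  by rewrite !mxE mulrAC [_ * U j o]mulrC mul_conjc.
have HzE : H - z%:M = block_mx (h%:C - z)%:M r r^T
    (diag_mx (\row_j (mu j)%:C) - z%:M).
  rewrite [z%:M]scalar_mx_block opp_block_mx add_block_mx !oppr0 !addr0.
  by rewrite -raddfB.
rewrite HzE -[G]submxK mulmx_block scalar_mx_block in hr.
have [h1 _ h2 _] := eq_block_mx hr.
rewrite -Goo.
have -> : G o o = ulsubmx G 0 0 by rewrite !mxE.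
move: (ulsubmx G) (dlsubmx G) h1 h2 => s t h1 h2.
(* The lower left block of the resolvent equation gives t in terms of s; inserted into the corner
   equation, it produces the Schur complement h - z - sum_j u_j / (mu_j - z). *)
have ht : t = - (diag_mx (\row_j ((mu j)%:C - z)^-1) *m r^T *m s).
  have hE := mulmx1C (diag_resolvent mu z0).
  rewrite -[LHS]mul1mx -hE -!mulmxA.
  move/eqP: h2; rewrite addrC addr_eq0 => /eqP ->.
  by rewrite mulmxN.
have := congr1 (fun M : 'M[R[i]]_1 => M 0 0) h1.
rewrite ht mul_scalar_mx mulmxN mulmxA mxE => h3.
rewrite [RHS](_ : _ = (1%:M : 'M[R[i]]_1) 0 0); last by rewrite mxE eqxx.
rewrite -h3 mulrBl; congr (_ + _); first by rewrite mxE.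
rewrite !mxE big_ord1; congr (- (_ * _)).
rewrite mulmxA mul_mx_diag mxE; apply: eq_bigr => j _; rewrite !mxE.
by rewrite mulrAC -realCM -expr2 sqr_sqrtr.
Qed.

End Realization.

Section FixmapRealization.
Variables (R : realType) (k n p : nat) (ns : 'I_k -> nat).
Variables C B : 'I_k -> 'M[R[i]]_p.
Hypothesis CB : forall b, C b = (B b)^t* *m B b.
Hypotheses (n_gt0 : (0 < n)%N) (p_gt0 : (0 < p)%N).
Hypothesis ns_gt0 : forall a, (0 < ns a)%N.

Local Notation c0 := (dim_ratio R n p).
Local Notation c := (class_ratio R n ns).
Local Notation arg := (resolvent_arg n ns C).

(** Each c_b g_b C_b is a sum over i of the C_b with coefficients c_b w_i / (c0 (l_i - z)). The rows
    of V are the rows of all B_b, one copy for each i, scaled by the square root of c_b w_i / c0.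
    Neither V nor d depends on z. *)
Lemma arg_realization N (w l : 'I_k -> 'I_N -> R) :
  (forall b j, 0 <= w b j) ->
  exists m (V : 'M[R[i]]_(m, p)) (d : 'I_m -> R),
    forall (z : R[i]) (g : 'rV[R[i]]_k),
      (forall b, c0%:C * g 0 b = stieltjes_sum (w b) (l b) z) ->
      arg g = 1%:M + V^t* *m diag_mx (\row_j ((d j)%:C - z)^-1) *m V.
Proof.
move=> w_ge0; pose J : finType := (('I_k * 'I_N) * 'I_p)%type.
pose e (s : 'I_k * 'I_N) := Num.sqrt (c s.1 * w s.1 s.2 / c0).
pose v (t : J) r := (e t.1)%:C * B t.1.1 t.2 r.
exists #|J|, (\matrix_(j, r) v (enum_val j) r),
  (fun j => l (enum_val j).1.1 (enum_val j).1.2) => z g hg.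
congr (_ + _); apply/matrixP => r s; rewrite summxE.
have c0C : (c0%:C : R[i]) != 0.
  by rewrite (fmorph_eq0 (real_complex R)) gt_eqF ?dim_ratio_gt0.
have gE b : g 0 b = (c0^-1)%:C * stieltjes_sum (w b) (l b) z.
  by rewrite -hg -realCV mulKf.
rewrite mul_mx_diag mxE.
transitivity (\sum_(t : J) (v t r)^* * ((l t.1.1 t.1.2)%:C - z)^-1 * v t s); last first.
  rewrite (reindex (@enum_val J J)) /=; last first.
    exact/onW_bij/enum_val_bij.
  by apply: eq_bigr => j _; rewrite !mxE.
rewrite -(pair_bigA _ (fun (bi : 'I_k * 'I_N) (q : 'I_p) =>
  (v (bi, q) r)^* * ((l bi.1 bi.2)%:C - z)^-1 * v (bi, q) s)) /=.
rewrite -(pair_bigA _ (fun b i => \sum_q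
  (v ((b, i), q) r)^* * ((l b i)%:C - z)^-1 * v ((b, i), q) s)) /=.
apply: eq_bigr => b _; rewrite mxE gE CB mxE /stieltjes_sum.
rewrite mulr_sumr mulr_sumr mulr_suml; apply: eq_bigr => i _.
rewrite mulr_sumr; apply: eq_bigr => q _; rewrite adjE /v /=.
have cw : 0 <= c b * w b i / c0.
  by rewrite divr_ge0 ?mulr_ge0 ?(ltW (class_ratio_gt0 _ _ _)) ?(ltW (dim_ratio_gt0 _ _ _)).
have cc (x : R[i]) : Num.conj x = conjc x by [].
rewrite ?cc (rmorphM (@conjc R)) /= [(_ +i* - 0)](conjc_real (e (b, i))).
have ee : (c b)%:C * ((c0^-1)%:C * (w b i)%:C) = (e (b, i))%:C * (e (b, i))%:C.
  by rewrite -!realCM -expr2 sqr_sqrtr //; congr (_%:C); ring.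
transitivity ((c b)%:C * ((c0^-1)%:C * (w b i)%:C) * ((l b i)%:C - z)^-1 *
  (conjc (B b q r) * B b q s)); first by ring.
by rewrite ee; ring.
Qed.

(** By [tr_inv_realization], [den] has the form h - z - sum_j u_j / (mu_j - z) with h = |B_a|^2 / p
    and u_j >= 0; [arrowhead_realization] writes its inverse, which is c0 T(g)_a, as the transform
    of a law of mass 1. *)
Lemma fixmap_realization N (w l : 'I_k -> 'I_N -> R) :
  (forall b j, 0 <= w b j) ->
  exists m (w' l' : 'I_k -> 'I_m -> R),
    [/\ forall b j, 0 <= w' b j, forall b, \sum_j w' b j = 1 &
      forall (z : R[i]) (g : 'rV[R[i]]_k), complex.Im z != 0 ->
        (forall b, c0%:C * g 0 b = stieltjes_sum (w b) (l b) z) ->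
        forall a, c0%:C * fixmap n ns C z g 0 a = stieltjes_sum (w' a) (l' a) z].
Proof.
move=> w_ge0; have [m [V [d hV]]] := arg_realization l w_ge0.
have pV : 0 < (p%:R^-1 : R) by rewrite invr_gt0 ltr0n.
have h a : exists wl : ('I_(1 + m) -> R) * ('I_(1 + m) -> R),
    [/\ forall j, 0 <= wl.1 j, \sum_j wl.1 j = 1 &
      forall (z : R[i]) (g : 'rV[R[i]]_k), complex.Im z != 0 ->
        (forall b, c0%:C * g 0 b = stieltjes_sum (w b) (l b) z) ->
        c0%:C * fixmap n ns C z g 0 a = stieltjes_sum wl.1 wl.2 z].
  have [mu [u [u_ge0 hu]]] := tr_inv_realization (B a) V d.
  have pu_ge0 j : 0 <= p%:R^-1 * u j by rewrite mulr_ge0 // ltW.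
  have [w1 [l1 [w1_ge0 w1_sum h1]]] :=
    arrowhead_realization (p%:R^-1 * fro2 (B a)) mu pu_ge0.
  exists (w1, l1); split => // z g z0 hg; have := h1 z z0.
  have -> : (p%:R^-1 * fro2 (B a))%:C - z -
      stieltjes_sum (fun j => p%:R^-1 * u j) mu z = den n ns C z g a.
    rewrite /den (hV z g hg) CB hu // natrC realCV mulrBr realCM.
    rewrite addrCA addrA; congr (_ - _); rewrite /stieltjes_sum mulr_sumr.
    by apply: eq_bigr => j _; rewrite realCM mulrA.
  move=> hd; rewrite mxE invfM mulrA.
  have c0C : (c0%:C : R[i]) != 0.
    by rewrite (fmorph_eq0 (real_complex R)) gt_eqF ?dim_ratio_gt0.
  rewrite mulfV // mul1r.
  have d0 : den n ns C z g a != 0.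
    by apply: contra_eq_neq hd => ->; rewrite mul0r eq_sym oner_neq0.
  by apply: (mulfI d0); rewrite mulfV.
have [f hf] := choice h.
exists (1 + m)%N, (fun a => (f a).1), (fun a => (f a).2); split.
- by move=> b; case: (hf b).
- by move=> b; case: (hf b).
- by move=> z g z0 hg a; have [_ _] := hf a; apply.
Qed.

End FixmapRealization.

(** * Location of the poles of the iterates *)

Section Poles.
Variable R : realType.

Lemma finite_max (I : finType) (i0 : I) (F : I -> R) :
  exists i, forall j, F j <= F i.
Proof.
by case: (@arg_maxP _ _ _ i0 xpredT F isT) => i _ h; exists i => j; apply: h.
Qed.

(* Above a pole l_i of weight w_i, the imaginary part is at least w_i / e at
   height e. *)
Lemma stieltjes_sum_pole m (w l : 'I_m -> R) (i : 'I_m) (b : R) :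
  (forall j, 0 <= w j) ->
  (forall e, 0 < e -> complex.Im (stieltjes_sum w l (l i +i* e)) <= b) -> w i = 0.
Proof.
move=> w_ge0 hb; apply/eqP; rewrite eq_le w_ge0 andbT.
have key e : 0 < e -> w i <= e * b.
  move=> e0; apply: le_trans (ler_wpM2l (ltW e0) (hb e e0)).
  rewrite /stieltjes_sum Im_sum mulr_sumr (bigD1 i) //.
  rewrite -[leLHS]addr0 lerD //; last first.
    apply: sumr_ge0 => j _; rewrite ImZ Im_invc ImD ImN /= add0r opprK.
    by rewrite !mulr_ge0 ?invr_ge0 ?sqn_ge0 // ltW.
  rewrite ImZ Im_invc /sqn /= subrr expr0n /= !add0r opprK sqrrN.
  rewrite le_eqVlt; apply/orP; left; apply/eqP; field.
  by rewrite gt_eqF.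
rewrite leNgt; apply/negP => w0.
have b0 : 0 < b by have := key 1 ltr01; rewrite mul1r; apply: lt_le_trans.
(* At this height the bound reads w_i <= w_i / 2. *)
have := key (w i / (2 * b)) (divr_gt0 w0 (mulr_gt0 (ltr0n _ 2) b0)).
have -> : w i / (2 * b) * b = w i / 2 by field; rewrite gt_eqF.
by lra.
Qed.

End Poles.

Section Iterates.
Variables (R : realType) (k n p : nat) (ns : 'I_k -> nat).
Variables C B : 'I_k -> 'M[R[i]]_p.
Hypothesis CB : forall b, C b = (B b)^t* *m B b.
Hypotheses (n_gt0 : (0 < n)%N) (p_gt0 : (0 < p)%N).
Hypothesis ns_gt0 : forall a, (0 < ns a)%N.

Local Notation c0 := (dim_ratio R n p).
Local Notation c := (class_ratio R n ns).
Local Notation arg := (resolvent_arg n ns C).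
Local Notation T := (fixmap n ns C).
Implicit Types (z : R[i]) (g : 'rV[R[i]]_k) (a b : 'I_k).

(* [c0] times the starting point is the Stieltjes transform of the Dirac mass
   at 0. *)
Definition iterate z t : 'rV[R[i]]_k :=
  iter t (T z) (const_mx (- (c0%:C * z)^-1)).

Let c0_gt0 : 0 < c0. Proof. exact: dim_ratio_gt0. Qed.

Let c_ge0 b : 0 <= c b. Proof. by rewrite divr_ge0. Qed.

Let c0C : (c0%:C : R[i]) != 0.
Proof. by rewrite (fmorph_eq0 (real_complex R)) gt_eqF. Qed.

Lemma iterate_realization t : exists m (w l : 'I_k -> 'I_m -> R),
  [/\ forall b j, 0 <= w b j, forall b, \sum_j w b j = 1 &
    forall z, complex.Im z != 0 -> forall a,
      c0%:C * iterate z t 0 a = stieltjes_sum (w a) (l a) z].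
Proof.
elim: t => [|t [m [w [l [w0 _ hw]]]]]; last first.
  have [m' [w' [l' [w'0 w'1 hw']]]] := fixmap_realization ns CB n_gt0 p_gt0 l w0.
  by exists m', w', l'; split => // z z0 a; apply: hw' => // b; exact: hw.
exists 1, (fun _ _ => 1), (fun _ _ => 0); split => //.
  by move=> b; rewrite big_ord1.
move=> z z0 a; rewrite mxE /stieltjes_sum big_ord1 invfM mulrN mulrA.
by rewrite mulfV // mul1r sub0r invrN mul1r.
Qed.

Section UpperHalfPlane.
Variable z : R[i].
Hypothesis z_gt0 : 0 < complex.Im z.

Let z0 : z != 0.
Proof. by apply: Im_neq0; rewrite gt_eqF. Qed.

Let nz0 : 0 < normc z.
Proof. by rewrite lt0r normc_ge0 normc_eq0 z0. Qed.

Lemma Im_iterate_gt0_and_dom t :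
  (forall b, 0 < complex.Im (iterate z t 0 b)) /\ half_plane_dom z (iterate z t).
Proof.
elim: t => [|t [_ IH]]; last first.
  split => [b|]; first exact: (Im_fixmap_gt0 CB).
  exact: (fixmap_dom CB).
have h b : 0 < complex.Im (iterate z 0 0 b).
  rewrite mxE invfM realCV ImN ImZ Im_invc mulNr mulrN opprK.
  by rewrite mulr_gt0 ?invr_gt0 // divr_gt0 // sqn_gt0.
split => // b; split; first exact/ltW.
(* z times the starting value is the real number - 1 / c0, so the second inequality is an
   equality. *)
rewrite mxE invfM realCV mulrN ImN mulrCA mulfV // mulr1 /=.
by rewrite oppr0.
Qed.

Lemma Im_iterate_gt0 t b : 0 < complex.Im (iterate z t 0 b).
Proof. by case: (Im_iterate_gt0_and_dom t). Qed.

Lemma iterate_dom t : half_plane_dom z (iterate z t).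
Proof. by case: (Im_iterate_gt0_and_dom t). Qed.

Lemma normc_iterate0 b : c0 * normc (iterate z 0 0 b) = (normc z)^-1.
Proof.
rewrite mxE normcN normcV normcM normc_real gtr0_norm // invfM mulrA.
by rewrite mulfV ?gt_eqF // mul1r.
Qed.

Lemma normc_iterate t b : c0 * normc (iterate z t 0 b) <= (complex.Im z)^-1.
Proof.
case: t => [|t]; last exact: (normc_fixmap CB n_gt0 p_gt0 ns_gt0 z_gt0 (iterate_dom t)).
rewrite normc_iterate0 lef_pV2 //.
exact: le_trans (ler_norm _) (le_Im_normc _).
Qed.

Definition class_entry_sum : R := \sum_b c b * \sum_i \sum_j normc (C b i j).

(* For [|z|] above this bound, the ball [c0 |g_b| <= 2 / |z|] is invariant under
   the fixed-point map, which excludes poles of the iterates beyond it. *)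
Definition support_bound : R :=
  1 + 4 * (class_entry_sum / c0) + 4 * (p%:R^-1 * entry_sum C).

Lemma class_entry_sum_ge0 : 0 <= class_entry_sum.
Proof.
apply: sumr_ge0 => b _; rewrite mulr_ge0 ?c_ge0 //.
by do 2![apply: sumr_ge0 => ? _]; exact: normc_ge0.
Qed.

Let r1_ge0 : 0 <= class_entry_sum / c0.
Proof. by rewrite divr_ge0 ?class_entry_sum_ge0 // ltW. Qed.

Let r2_ge0 : 0 <= p%:R^-1 * entry_sum C.
Proof. by rewrite mulr_ge0 ?entry_sum_ge0 ?invr_ge0. Qed.

Lemma support_bound_gt0 : 0 < support_bound.
Proof. by move: r1_ge0 r2_ge0; rewrite /support_bound; lra. Qed.

(** The row sum is at most (2 / |z|) [class_entry_sum] / c0; the first factor 4 in [support_bound]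
    makes this at most 1/2. *)
Lemma perturbation_row g i : support_bound <= normc z ->
  (forall b, c0 * normc (g 0 b) <= 2 / normc z) ->
  \sum_j normc ((arg g - 1%:M) i j) <= 2^-1.
Proof.
move=> hz hg; rewrite /resolvent_arg addrC addKr.
have hN j : normc ((\sum_b ((c b)%:C * g 0 b) *: C b) i j) <=
    (2 / normc z) / c0 * \sum_b c b * normc (C b i j).
  rewrite summxE; apply: le_trans (le_normc_sum _) _; rewrite mulr_sumr.
  apply: ler_sum => b _; rewrite mxE !normcM normc_real ger0_norm ?c_ge0 //.
  rewrite mulrAC [leRHS]mulrC ler_wpM2l //.
    by rewrite mulr_ge0 ?normc_ge0 ?c_ge0.
  by rewrite ler_pdivlMr // mulrC.
apply: le_trans (ler_sum _ (fun j _ => hN j)) _; rewrite -mulr_sumr exchange_big /=.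
have hS : \sum_b \sum_j c b * normc (C b i j) <= class_entry_sum.
  apply: ler_sum => b _; rewrite -mulr_sumr ler_wpM2l ?c_ge0 //.
  rewrite [leRHS](bigD1 i) //= lerDl.
  by do 2![apply: sumr_ge0 => ? _]; exact: normc_ge0.
apply: (@le_trans _ _ ((2 / normc z) / c0 * class_entry_sum)).
  by apply: ler_wpM2l hS; rewrite !mulr_ge0 ?invr_ge0 // ltW.
have -> : 2 / normc z / c0 * class_entry_sum = 2 * (class_entry_sum / c0) / normc z.
  by field; rewrite !gt_eqF.
rewrite ler_pdivrMr //; move: r1_ge0 r2_ge0 hz; rewrite /support_bound; lra.
Qed.

(** Since Q = 1 - (arg g - 1) Q, the largest modulus q of an entry of Q satisfies q <= 1 + q / 2. *)
Lemma inv_arg_entry_large g : half_plane_dom z g -> support_bound <= normc z ->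
  (forall b, c0 * normc (g 0 b) <= 2 / normc z) ->
  forall i j, normc (invmx (arg g) i j) <= 2.
Proof.
move=> g_dom hz hg i j; set Q := invmx _.
have [[i0 j0] hmax] :=
  finite_max (i, j) (fun s : 'I_p * 'I_p => normc (Q s.1 s.2)).
apply: le_trans (hmax (i, j)) _ => /=; set q := normc (Q i0 j0).
have QE : Q = 1%:M - (arg g - 1%:M) *m Q.
  by rewrite mulmxBl mulmxV ?(arg_unit CB n_gt0 ns_gt0 z_gt0 g_dom) // mul1mx subKr.
have h1 : normc ((1%:M : 'M[R[i]]_p) i0 j0) <= 1.
  by rewrite mxE natrC normc_real normr_nat lern1 leq_b1.
have h2 : normc (((arg g - 1%:M) *m Q) i0 j0) <= 2^-1 * q.
  rewrite mxE; apply: le_trans (le_normc_sum _) _.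
  apply: (@le_trans _ _ (\sum_l normc ((arg g - 1%:M) i0 l) * q)).
    apply: ler_sum => l _; rewrite normcM ler_wpM2l ?normc_ge0 //.
    exact: (hmax (l, j0)).
  by rewrite -mulr_suml ler_wpM2r ?normc_ge0 ?perturbation_row.
have h3 : q <= 1 + 2^-1 * q.
  rewrite {1}/q QE mxE; apply: le_trans (le_normcD _ _) _.
  by rewrite [X in _ + normc X]mxE normcN lerD.
by lra.
Qed.

(** As the entries of Q are at most 2, the trace term of [den] is at most 2 [entry_sum] / p <= |z| /
    2, by the second factor 4 in [support_bound]. Hence |[den]| >= |z| / 2, and the bound passes to
    the next iterate. *)
Lemma normc_iterate_large t b : support_bound <= normc z ->
  c0 * normc (iterate z t 0 b) <= 2 / normc z.
Proof.
move=> hz; elim: t b => [|t IH] b.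
  by rewrite normc_iterate0 ler_peMl ?invr_ge0 ?(ltW nz0) // ler1n.
have hQ := inv_arg_entry_large (iterate_dom t) hz IH.
have htr := normc_tr_le C b (ler0n R 2) hQ.
set g := iterate z t in hQ htr.
have hd : normc z / 2 <= normc (den n ns C z g b).
  have := le_normcD (den n ns C z g b) (- (p%:R^-1 * \tr (C b *m invmx (arg g)))).
  rewrite {1}/den addrK !normcN normcM natrC realCV normc_real.
  rewrite gtr0_norm ?invr_gt0 ?ltr0n //.
  have hp : 0 <= (p%:R^-1 : R) by rewrite invr_ge0.
  have := ler_wpM2l hp htr; rewrite mulrA.
  move: r1_ge0 r2_ge0 hz; rewrite /support_bound.
  set x1 := class_entry_sum / c0; set x2 := _ * entry_sum C.
  set x3 := _ * normc (\tr _); set x4 := normc (den _ _ _ _ _ _).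
  by lra.
have hd0 : 0 < normc (den n ns C z g b).
  by apply: lt_le_trans hd; rewrite divr_gt0.
rewrite /= mxE normcV normcM normc_real gtr0_norm // invfM mulrA mulfV ?gt_eqF //.
rewrite mul1r -[leRHS]invrK lef_pV2 ?posrE ?invr_gt0 ?divr_gt0 //.
by rewrite invfM invrK mulrC.
Qed.

End UpperHalfPlane.

(** Write G = c0 g at z = l_i + e i. Then 0 <= Im (z G) = l_i Im G + e Re G, and e Re G <= e |G| <=
    1, so Im G <= 1 / (- l_i) at every height e, which excludes a pole. *)
Lemma iterate_pole_lt0 m (w l : 'I_m -> R) t a i :
  (forall j, 0 <= w j) ->
  (forall z, complex.Im z != 0 -> c0%:C * iterate z t 0 a = stieltjes_sum w l z) ->
  l i < 0 -> w i = 0.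
Proof.
move=> w0 hw li; apply: (stieltjes_sum_pole (l := l) (b := (- l i)^-1) w0) => e e0.
set z := l i +i* e; have z0 : 0 < complex.Im z by [].
rewrite -hw ?gt_eqF //; set g := iterate z t 0 a.
have h1 : 0 <= complex.Im (z * g) by case: (iterate_dom z0 t a).
have h2 : c0 * normc g <= e^-1 := normc_iterate z0 t a.
have h3 : complex.Im (z * (c0%:C * g)) = l i * complex.Im (c0%:C * g) +
   e * complex.Re (c0%:C * g).
  by rewrite /z; case: (c0%:C * g) => u v /=; ring.
have h4 : 0 <= complex.Im (z * (c0%:C * g)).
  by rewrite mulrCA ImZ mulr_ge0 // ltW.
have h5 : complex.Re (c0%:C * g) <= e^-1.
  rewrite ReZ; apply: le_trans h2; rewrite ler_wpM2l ?(ltW c0_gt0) //.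
  exact: le_trans (ler_norm _) (le_Re_normc _).
rewrite -[leRHS]mul1r ler_pdivlMr ?oppr_gt0 //.
have h6 : e * complex.Re (c0%:C * g) <= 1.
  by rewrite -(mulfV (lt0r_neq0 e0)) ler_wpM2l // ltW.
by rewrite h3 in h4; rewrite mulrN mulrC; lra.
Qed.

(** Above such a point |z| exceeds [support_bound], so the transform is at most 2 / [support_bound]
    in modulus at every height. *)
Lemma iterate_pole_large m (w l : 'I_m -> R) t a i :
  (forall j, 0 <= w j) ->
  (forall z, complex.Im z != 0 -> c0%:C * iterate z t 0 a = stieltjes_sum w l z) ->
  support_bound < l i -> w i = 0.
Proof.
move=> w0 hw li; apply: (stieltjes_sum_pole (l := l) (b := 2 / support_bound) w0) => e e0.
set z := l i +i* e; have z0 : 0 < complex.Im z by [].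
rewrite -hw ?gt_eqF //; set g := iterate z t 0 a.
have hz : support_bound <= normc z.
  apply: le_trans (ltW li) _.
  exact: le_trans (ler_norm _) (@le_Re_normc _ z).
have h2 : c0 * normc g <= 2 / normc z := normc_iterate_large z0 t a hz.
rewrite ImZ; apply: le_trans (le_trans h2 _).
  rewrite ler_wpM2l ?(ltW c0_gt0) //.
  exact: le_trans (ler_norm _) (le_Im_normc _).
rewrite ler_wpM2l // lef_pV2 // posrE ?support_bound_gt0 //.
exact: lt_le_trans support_bound_gt0 hz.
Qed.

Lemma iterate_stieltjes_sum t : exists m (w l : 'I_k -> 'I_m -> R),
  [/\ forall a j, 0 <= w a j, forall a, \sum_j w a j = 1,
    forall a j, 0 <= l a j <= support_bound &
    forall z, complex.Im z != 0 -> forall a,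
      c0%:C * iterate z t 0 a = stieltjes_sum (w a) (l a) z].
Proof.
have [m [w [l [w0 w1 hw]]]] := iterate_realization t.
(* Atoms outside the interval have weight 0; they are moved to 0. *)
exists m, w, (fun a j => if 0 <= l a j <= support_bound then l a j else 0).
split => //.
  by move=> a j; case: ifP => // _; rewrite lexx ltW ?support_bound_gt0.
move=> z z0 a; rewrite hw //; apply: eq_bigr => j _; case: ifPn => // h.
suff -> : w a j = 0 by rewrite !mul0r.
have ha z' : complex.Im z' != 0 ->
  c0%:C * iterate z' t 0 a = stieltjes_sum (w a) (l a) z' by move=> ?; exact: hw.
move: h; rewrite negb_and -!ltNge => /orP[h|h].
  exact: (iterate_pole_lt0 (w0 a) ha h).
exact: (iterate_pole_large (w0 a) ha h).
Qed.

End Iterates.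

(** * Selection of a limit law *)

(** Compactness gives a cluster point. If a neighbourhood of it were missed by the image
    ultrafilter, the complement would belong to it, against clustering. *)
Lemma ultra_bounded_cvg (R : realType) (U : set_system nat) (u : nat -> R) (a b : R) :
  UltraFilter U -> (forall n, a <= u n <= b) ->
  exists2 y, a <= y <= b & u n @[n --> U] --> y.
Proof.
move=> UU hu.
have PF : ProperFilter (u @ U) by exact: fmap_proper_filter.
have Uab : (u @ U) `[a, b].
  by apply: (@filterE _ U) => n; rewrite /= in_itv; exact: hu.
have [y [yab yU]] := segment_compact PF Uab.
exists y; first by move: yab; rewrite /= in_itv.
move=> A Ay; have [//|UnA] := in_ultra_setVsetC (u @^-1` A) UU.
have [x [] //] := yU _ _ (UnA : (u @ U) (~` A)) Ay.
Qed.

Section RightHull.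
Variables (R : realType) (F : R -> R) (M : R).
Hypothesis F_nd : {homo F : x y / x <= y}.
Hypothesis F_lt0 : forall x, x < 0 -> F x = 0.
Hypothesis F_geM : forall x, M <= x -> F x = 1.

(* A pointwise limit of distribution functions need not be right-continuous. *)
Definition right_hull x : R := inf [set F y | y in [set y | x < y]].

Let set_nonempty x : [set F y | y in [set y | x < y]] !=set0.
Proof. by exists (F (x + 1)), (x + 1) => //=; rewrite ltrDl. Qed.

Lemma right_hull_ge x : F x <= right_hull x.
Proof. by apply: lb_le_inf => // _ [y /= /ltW xy <-]; exact: F_nd. Qed.

Lemma right_hull_le x y : x < y -> right_hull x <= F y.
Proof.
move=> xy; apply: ge_inf; last by exists y.
by exists (F x) => _ [t /= /ltW xt <-]; exact: F_nd.
Qed.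

Lemma right_hull_nd : nondecreasing right_hull.
Proof.
move=> x y; rewrite le_eqVlt => /predU1P[-> //|xy].
exact: le_trans (right_hull_le xy) (right_hull_ge y).
Qed.

Lemma right_hull_rc : right_continuous right_hull.
Proof.
move=> x; apply/cvgrPdist_lt => e e0.
have hinf : has_inf [set F y | y in [set y | x < y]].
  by split => //; exists (F x) => _ [t /= /ltW xt <-]; exact: F_nd.
have [_ [y /= xy <-] hy] := inf_adherent e0 hinf.
near=> t.
have xt : x < t by near: t; exact: nbhs_right_gt.
have ty : t < y by near: t; exact: nbhs_right_lt.
rewrite distrC ger0_norm ?subr_ge0 ?right_hull_nd ?ltW //.
rewrite ltrBlDl; apply: le_lt_trans (right_hull_le ty) hy.
Unshelve. all: by end_near. Qed.

HB.instance Definition _ :=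
  isCumulative.Build R _ R right_hull right_hull_nd right_hull_rc.

Lemma right_hull_lt0 x : x < 0 -> right_hull x = 0.
Proof.
move=> x0; apply/eqP; rewrite eq_le -{2}(F_lt0 x0) right_hull_ge andbT.
have h : x < x / 2 by lra.
by apply: le_trans (right_hull_le h) _; rewrite F_lt0 //; lra.
Qed.

Lemma right_hull_geM x : M <= x -> right_hull x = 1.
Proof.
move=> xM; apply/eqP; rewrite eq_le -{2}(F_geM xM) right_hull_ge andbT.
have h : x < x + 1 by rewrite ltrDl.
apply: le_trans (right_hull_le h) _; rewrite F_geM //.
by rewrite (le_trans xM) // lerDl.
Qed.

Let right_hullNy : right_hull @ -oo --> (0 : R).
Proof.
apply: cvg_near_cst; near=> x; apply: right_hull_lt0.
by near: x; exact: nbhs_ninfty_lt.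
Unshelve. all: by end_near. Qed.

Let right_hully : right_hull @ +oo --> (1 : R).
Proof.
apply: cvg_near_cst; near=> x; apply: right_hull_geM.
by near: x; apply: nbhs_pinfty_ge; rewrite num_real.
Unshelve. all: by end_near. Qed.

HB.instance Definition _ :=
  isCumulativeBounded.Build R 0 1 right_hull right_hullNy right_hully.

Definition hull_law : probability (measurableTypeR R) R :=
  lebesgue_stieltjes_measure right_hull.

Lemma hull_law_itv x : hull_law `]-oo, x] = (right_hull x)%:E.
Proof. by rewrite -cdf_lebesgue_stieltjes_id. Qed.

Lemma hull_law_gt x : hull_law `]x, +oo[ = (1 - right_hull x)%:E.
Proof.
have -> : `]x, +oo[%classic = ~` `]-oo, x]%classic by rewrite setCitvl.
by rewrite probability_setC ?hull_law_itv // EFinB.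
Qed.

(** The right hull may jump at 0, so the open half line is exhausted by closed ones at whose end
    points the hull vanishes. *)
Lemma hull_law_lt0 : hull_law `]-oo, 0[ = 0%E.
Proof.
apply/(@measure_negligible _ _ _ hull_law) => //.
have -> : `]-oo, (0 : R)[%classic = \bigcup_n `]-oo, - (n.+1%:R^-1 : R)]%classic.
  apply/seteqP; split => x /=.
    rewrite in_itv /= => x0; have Nx : 0 < - x by rewrite oppr_gt0.
    exists (Num.truncn (- x)^-1) => //=; rewrite in_itv /= lerNr.
    by rewrite invf_ple ?posrE // ltW // truncnS_gt.
  by move=> [n _] /=; rewrite !in_itv /= => /le_lt_trans; apply; rewrite oppr_lt0.
apply: negligible_bigcup => n; apply/negligibleP => //.
by rewrite [LHS]hull_law_itv right_hull_lt0 // oppr_lt0.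
Qed.

Lemma hull_law_supp : 0 <= M -> hull_law `[0, M] = 1%E.
Proof.
move=> M_ge0.
have e : `]-oo, M]%classic = `]-oo, (0 : R)[%classic `|` `[0, M]%classic.
  apply/seteqP; split => x /=; rewrite !in_itv /=; last first.
    by move=> [x0|/andP[]//]; rewrite ltW // (lt_le_trans x0).
  by move=> xM; case: ltP => x0; [left|right; rewrite xM].
have := hull_law_itv M; rewrite right_hull_geM // e measureU //.
  by rewrite [X in (X + _)%E]hull_law_lt0 add0e.
apply/seteqP; split => // x []/=; rewrite !in_itv /= => x0 /andP[h _].
by move: (lt_le_trans x0 h); rewrite ltxx.
Qed.

End RightHull.

(** * Staircase approximation and integrals of bounded Lipschitz functions *)

Section StepApproximation.
Variables (R : realType) (f : R -> R) (K delta : R).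
Hypothesis f_lip : forall x y, `|f x - f y| <= K * `|x - y|.
Hypotheses (K_ge0 : 0 <= K) (delta_ge0 : 0 <= delta).

Definition jump i : R := f (i.+1%:R * delta) - f (i%:R * delta).

(** A staircase equal to f ((i + 1) delta) for i delta < t <= (i + 1) delta. As a combination of
    indicators of half lines, its integral involves a distribution function only at the grid
    points. *)
Definition step_approx m (t : R) : R :=
  f 0 + \sum_(i < m) jump i * ((i%:R * delta < t)%R : nat)%:R.

Lemma jump_le i : `|jump i| <= K * delta.
Proof.
apply: le_trans (f_lip _ _) _; rewrite -mulrBl -natrB // subSnn mul1r.
by rewrite ger0_norm.
Qed.

(** The second clause, the value beyond the last grid point, carries the induction. *)
Lemma step_approxP m t : 0 <= t ->
  (t <= m%:R * delta -> `|step_approx m t - f t| <= K * delta) /\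
  (m%:R * delta < t -> step_approx m t = f (m%:R * delta)).
Proof.
move=> t0; elim: m => [|m [IH1 IH2]].
  rewrite mul0r; split => [t_le0|_]; last by rewrite /step_approx big_ord0 addr0.
  have -> : t = 0 by apply/eqP; rewrite eq_le t_le0.
  by rewrite /step_approx big_ord0 addr0 subrr normr0 mulr_ge0.
have mS : m%:R * delta <= m.+1%:R * delta by rewrite ler_wpM2r // ler_nat.
rewrite /step_approx big_ord_recr /= addrA -/(step_approx m t).
have [tm|mt] := leP t (m%:R * delta); rewrite ?mulr0 ?addr0 ?mulr1.
  split => [_|]; first exact: IH1.
  by move=> h; have := lt_le_trans h (le_trans tm mS); rewrite ltxx.
rewrite (IH2 mt) /jump addrC subrK; split => // tmS.
apply: le_trans (f_lip _ _) _; rewrite ler_wpM2l // ger0_norm ?subr_ge0 //.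
by rewrite -natr1 mulrDl mul1r lerBlDr [leRHS]addrC lerD2r ltW.
Qed.

End StepApproximation.

Lemma lipschitz_measurable (R : realType) (f : R -> R) (K : R) :
  (forall x y, `|f x - f y| <= K * `|x - y|) ->
  measurable_fun setT (f : measurableTypeR R -> R).
Proof.
move=> f_lip.
have K0 : 0 <= K.
  by have := f_lip 1 0; rewrite subr0 normr1 mulr1; exact: le_trans.
apply: continuous_measurable_fun => t; apply/cvgrPdist_lt => eps eps0.
have K1 : 0 < K + 1 by rewrite ltr_wpDl.
near=> s; apply: le_lt_trans (f_lip _ _) _.
apply: (@le_lt_trans _ _ ((K + 1) * `|t - s|)).
  by rewrite ler_wpM2r // lerDl.
rewrite mulrC -ltr_pdivlMr //.
near: s; exact: (cvgr_dist_lt _ _ (@cvg_id _ (nbhs t)) _ (divr_gt0 eps0 K1)).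
Unshelve. all: by end_near. Qed.

Section BoundedIntegrals.
Variables (R : realType) (P : probability (measurableTypeR R) R).

Lemma probability_bounded_integrable (g : R -> R) (c : R) :
  measurable_fun setT (g : measurableTypeR R -> _) -> (forall t, `|g t| <= c) ->
  P.-integrable setT (EFin \o g).
Proof.
move=> mg gc; apply: measurable_bounded_integrable => //.
  by rewrite ltey_eq fin_num_measure.
exists c; split; first by rewrite num_real.
by move=> x cx t _ /=; exact: le_trans (gc t) (ltW cx).
Qed.

Lemma Rintegral_bound (g : R -> R) (D : set R) (c e : R) :
  measurable_fun setT (g : measurableTypeR R -> _) -> (forall t, `|g t| <= c) ->
  0 <= e -> measurable D -> P D = 1%E -> (forall t, D t -> `|g t| <= e) ->
  `|\int[P]_t g t| <= e.
Proof.
move=> mg gc e0 mD PD ge.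
have ig := probability_bounded_integrable mg gc.
apply: le_trans (le_normr_Rintegral _ ig) _ => //.
have mng : measurable_fun setT ((fun t => `|g t|) : measurableTypeR R -> R).
  exact: measurableT_comp.
have ing : P.-integrable setT (EFin \o (fun t => `|g t|)).
  by apply: (probability_bounded_integrable (c := c)) mng _ => t; rewrite normr_id.
have mDc : measurable (~` D) by exact: measurableC.
have DT : D `|` ~` D = setT by rewrite setUv.
rewrite -DT Rintegral_setU //; last 2 first.
- by rewrite DT.
- by apply/disj_setPS; rewrite setICr.
have PDc : P (~` D) = 0%E.
  by rewrite probability_setC // PD subee.
rewrite [X in _ + X](_ : _ = 0) ?addr0; last first.
  rewrite /Rintegral null_set_integral //.
  apply/measurable_EFinP; exact: measurable_funS mng.
have -> : e = \int[P]_(t in D) e by rewrite Rintegral_cst // [X in fine X](_ : _ = 1%E) ?mulr1 //; exact: PD.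
apply: le_Rintegral => //.
- by apply: integrableS ing.
- apply: (integrableS (E := setT)) => //.
  apply: (probability_bounded_integrable (c := `|e|)) => //.
Qed.

End BoundedIntegrals.

Section StepIntegral.
Variables (R : realType) (P : probability (measurableTypeR R) R) (G : R -> R).
Hypothesis PG : forall x, P `]x, +oo[ = (1 - G x)%:E.
Variables (f : R -> R) (delta : R).

Lemma step_approx_integral m :
  [/\ measurable_fun setT (step_approx f delta m : measurableTypeR R -> R),
     exists c, forall t, `|step_approx f delta m t| <= c &
     \int[P]_t step_approx f delta m t =
       f 0 + \sum_(i < m) jump f delta i * (1 - G (i%:R * delta))].
Proof.
elim: m => [|m [mm [c hc] hI]].
  have -> : step_approx f delta 0 = cst (f 0).
    by apply/funext => t; rewrite /step_approx big_ord0 addr0.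
  split; first exact: measurable_cst.
  - by exists `|f 0| => t.
  - rewrite big_ord0 addr0 Rintegral_cst // [X in fine X](_ : _ = 1%E) ?mulr1 //.
    exact: probability_setT.
have E : step_approx f delta m.+1 = (fun t => step_approx f delta m t +
    jump f delta m * \1_(`]m%:R * delta, +oo[) t).
  apply/funext => t; rewrite /step_approx big_ord_recr /= addrA.
  by rewrite indicE mem_setE in_itv /= andbT.
have mi : measurable_fun setT (\1_(`]m%:R * delta, +oo[) : measurableTypeR R -> R).
  exact: measurable_indic.
have bi t : `|(\1_(`]m%:R * delta, +oo[) t : R)| <= 1.
  by rewrite indicE; case: (_ \in _); rewrite ?normr1 ?normr0.
have mj : measurable_fun setT ((fun t => jump f delta m *
    \1_(`]m%:R * delta, +oo[) t) : measurableTypeR R -> R).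
  exact: measurable_funM.
have bj t : `|jump f delta m * \1_(`]m%:R * delta, +oo[) t| <= `|jump f delta m|.
  by rewrite normrM ler_piMr.
rewrite E; split.
- exact: measurable_funD.
- exists (c + `|jump f delta m|) => t.
  exact: le_trans (ler_normD _ _) (lerD (hc t) (bj t)).
rewrite RintegralD //; last 2 first.
- exact: probability_bounded_integrable mm hc.
- exact: probability_bounded_integrable mj bj.
rewrite hI big_ord_recr /= addrA; congr (_ + _).
rewrite RintegralZl //; last exact: probability_bounded_integrable mi bi.
congr (_ * _); rewrite /Rintegral integral_indic // setIT.
exact: (congr1 fine (PG _)).
Qed.

End StepIntegral.

Section Selection.
Variables (R : realType) (M : R) (U : set_system nat).
Hypotheses (M_ge0 : 0 <= M) (UU : UltraFilter U).
Variables (N : nat -> nat) (w l : forall n, 'I_(N n) -> R).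
Hypothesis w_ge0 : forall n j, 0 <= @w n j.
Hypothesis w_sum : forall n, \sum_j @w n j = 1.
Hypothesis l_itv : forall n j, 0 <= @l n j <= M.

Let Fn n x : R := \sum_j @w n j * ((@l n j <= x)%R : nat)%:R.

Let Fn_itv x n : 0 <= Fn n x <= 1.
Proof.
apply/andP; split; first by apply: sumr_ge0 => j _; rewrite mulr_ge0 ?ler0n.
rewrite -(w_sum n); apply: ler_sum => j _; rewrite ler_piMr //.
by rewrite lern1 leq_b1.
Qed.

(** Helly selection along an ultrafilter: the distribution functions converge pointwise to F, and
    the right hull G of F defines nu. The staircase sums [b] link the discrete sum to the integral
    through [Fn], F and G. Comparing F with G over whole grid steps avoids any choice of continuity
    points. *)
Lemma law_selection : exists nu : probability (measurableTypeR R) R,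
  compactly_supported_in nu [set x | 0 <= x] /\
  forall (f : R -> R) (K c : R), (forall x y, `|f x - f y| <= K * `|x - y|) ->
    (forall t, `|f t| <= c) ->
    \sum_j @w n j * f (@l n j) @[n --> U] --> \int[nu]_t f t.
Proof.
have /choice[F hF] x : exists y : R, 0 <= y <= 1 /\ Fn n x @[n --> U] --> y.
  by have [y ? ?] := ultra_bounded_cvg UU (Fn_itv x); exists y.
have FU x : Fn n x @[n --> U] --> F x by case: (hF x).
have F_nd : {homo F : x y / x <= y}.
  move=> x y xy; apply: (ler_cvg_to (FU x) (FU y)); apply: nearW => n.
  apply: ler_sum => j _; rewrite ler_wpM2l // ler_nat.
  by case: leP => // h; rewrite (le_trans h xy).
have F_lt0 x : x < 0 -> F x = 0.
  move=> x0; apply: (cvg_unique (@norm_hausdorff _ R) (FU x)).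
  rewrite (_ : (fun n => Fn n x) = cst 0); first exact: cvg_cst.
  apply/funext => n; apply: big1 => j _; rewrite leNgt (lt_le_trans x0) ?mulr0 //.
  by case/andP: (l_itv j).
have F_geM x : M <= x -> F x = 1.
  move=> xM; apply: (cvg_unique (@norm_hausdorff _ R) (FU x)).
  rewrite (_ : (fun n => Fn n x) = cst 1); first exact: cvg_cst.
  apply/funext => n; rewrite /Fn -[RHS](w_sum n); apply: eq_bigr => j _.
  by rewrite (le_trans _ xM) ?mulr1 //; case/andP: (l_itv j).
pose G := right_hull F.
pose nu := hull_law F_nd F_lt0 F_geM.
have nuM : nu `[0, M] = 1%E := hull_law_supp F_nd F_lt0 F_geM M_ge0.
exists nu; split.
  exists `[0, M]; split => //; first exact: segment_compact.
  by move=> x /=; rewrite in_itv /= => /andP[].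
move=> f K c f_lip f_bd; apply/cvgrPdist_lt => e e0.
have K0 : 0 <= K.
  have := f_lip 1 0; rewrite subr0 normr1 mulr1; exact: le_trans.
have KM : 0 <= K * M by exact: mulr_ge0.
(* This m makes K delta < e / 6, so that the four errors below add up to less than e. The length M +
   1 keeps delta positive even for M = 0. *)
pose m := (Num.truncn (6 * (K * (M + 1)) / e)).+1.
have m0 : 0 < (m%:R : R) by rewrite ltr0n.
pose delta := (M + 1) / m%:R.
have d_gt0 : 0 < delta by rewrite divr_gt0 // ltr_wpDl.
have d0 := ltW d_gt0.
have md : m%:R * delta = M + 1 by rewrite mulrC divfK // gt_eqF.
have Kd : K * delta < e / 6.
  have : 6 * (K * (M + 1)) / e < m%:R by exact: truncnS_gt.
  rewrite ltr_pdivrMr // => h.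
  by rewrite /delta mulrA ltr_pdivrMr // mulrAC ltr_pdivlMr ?ltr0n // mulrC [e * _]mulrC.
pose x i : R := i%:R * delta.
pose b (H : R -> R) : R := f 0 + \sum_(i < m) jump f delta i * (1 - H (x i)).
have near_step t : 0 <= t <= M -> `|f t - step_approx f delta m t| <= K * delta.
  move=> /andP[t0 tM]; rewrite distrC.
  have [h _] := step_approxP f_lip K0 d0 m t0; apply: h.
  by rewrite md (le_trans tM) // lerDl.
have step1 n : `|\sum_j @w n j * f (@l n j) - b (Fn n)| <= K * delta.
  have -> : b (Fn n) = \sum_j @w n j * step_approx f delta m (@l n j).
    rewrite /step_approx.
    under eq_bigr => j _ do rewrite mulrDr mulr_sumr.
    rewrite big_split /= -mulr_suml w_sum mul1r; congr (_ + _).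
    rewrite exchange_big; apply: eq_bigr => i _ /=.
    rewrite -[X in X - _](w_sum n) /Fn -sumrB mulr_sumr; apply: eq_bigr => j _.
    by rewrite -/(x i); case: (leP (@l n j) (x i)) => _ /=; ring.
  rewrite -sumrB; apply: le_trans (ler_norm_sum _ _ _) _.
  rewrite -[leRHS]mul1r -(w_sum n) mulr_suml; apply: ler_sum => j _.
  by rewrite -mulrBr normrM ger0_norm // ler_wpM2l // near_step.
have step2 : b (Fn n) @[n --> U] --> b F.
  rewrite /b; apply: cvgD; first exact: cvg_cst.
  have : forall q, (\sum_(i < q) jump f delta i * (1 - Fn n (x i))) @[n --> U]
      --> \sum_(i < q) jump f delta i * (1 - F (x i)).
    elim => [|q IH].
      under eq_fun do rewrite big_ord0.
      by rewrite big_ord0; exact: cvg_cst.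
    under eq_fun do rewrite big_ord_recr /=.
    rewrite big_ord_recr /=; apply: cvgD; first exact: IH.
    apply: cvgM; first exact: cvg_cst.
    by apply: cvgB; [exact: cvg_cst|exact: FU].
  exact.
(* F (x_i) <= G (x_i) <= F (x_(i+1)), so the differences are dominated by a telescoping sum, which
   is at most 1. *)
have step3 : `|b F - b G| <= K * delta.
  rewrite /b opprD addrACA subrr add0r -sumrB.
  apply: le_trans (ler_norm_sum _ _ _) _.
  apply: (@le_trans _ _ (\sum_(i < m) K * delta * (F (x i.+1) - F (x i)))).
    apply: ler_sum => i _; rewrite -mulrBr normrM.
    have -> : 1 - F (x i) - (1 - G (x i)) = G (x i) - F (x i) by ring.
    have h1 : F (x i) <= G (x i) by exact: right_hull_ge.
    rewrite [X in _ * X]ger0_norm ?subr_ge0 //.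
    apply: ler_pM; rewrite ?normr_ge0 ?subr_ge0 //; first exact: jump_le.
    rewrite lerD2r; apply: right_hull_le => //.
    by rewrite /x ltr_pM2r // ltr_nat.
  rewrite -mulr_sumr -[leRHS]mulr1 ler_wpM2l //; first exact: mulr_ge0.
  have -> : \sum_(i < m) (F (x i.+1) - F (x i)) = F (x m) - F (x 0%N).
    elim: (m) => [|q IH]; first by rewrite big_ord0 subrr.
    by rewrite big_ord_recr /= IH addrC addrA subrK.
  have [[/andP[_ h1] _] [/andP[h2 _] _]] := (hF (x m), hF (x 0%N)).
  by rewrite lerBlDr ler_wpDr.
have step4 : `|\int[nu]_t f t - b G| <= K * delta.
  have PG y : nu `]y, +oo[ = (1 - G y)%:E := hull_law_gt F_nd F_lt0 F_geM y.
  have [ms [cs hcs] hint] := step_approx_integral PG f delta m.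
  rewrite (_ : b G = \int[nu]_t step_approx f delta m t); last exact: esym hint.
  have mf := lipschitz_measurable f_lip.
  have if_ := probability_bounded_integrable nu mf f_bd.
  have is_ := probability_bounded_integrable nu ms hcs.
  rewrite -RintegralB //.
  apply: (Rintegral_bound (D := `[0, M]%classic) (c := c + cs)) => //.
  - exact: measurable_funB.
  - by move=> t; apply: le_trans (ler_normB _ _) (lerD (f_bd t) (hcs t)).
  - exact: mulr_ge0.
have e6 : 0 < e / 6 by exact: divr_gt0.
apply: filterS (cvgr_dist_lt _ _ step2 _ e6) => n hn.
have s1 := step1 n.
set I := \int[nu]_t f t in step4 *; set S := \sum_j _ in s1 *.
have -> : I - S = (I - b G) - (b F - b G) + (b F - b (Fn n)) - (S - b (Fn n)).
  by ring.
apply: le_lt_trans (ler_normB _ _) _; apply: le_lt_trans (lerD (ler_normD _ _) s1) _.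
apply: le_lt_trans (lerD (lerD (ler_normB _ _) (lexx _)) (lexx _)) _.
by lra.
Qed.

End Selection.

(** * Solutions of the system *)

Section ConjcMorphism.
Variable R : realType.
Implicit Types (x y : R[i]).

Lemma conjcM x y : (x * y)^*%C = x^*%C * y^*%C.
Proof. exact: (rmorphM (@conjc R)). Qed.

Lemma conjcD x y : (x + y)^*%C = x^*%C + y^*%C.
Proof. exact: (rmorphD (@conjc R)). Qed.

Lemma conjcN x : (- x)^*%C = - x^*%C.
Proof. exact: (rmorphN (@conjc R)). Qed.

End ConjcMorphism.

Lemma cvg_lower_bound (R : realType) (U : set_system nat) (u : nat -> R) (x y : R) :
  ProperFilter U -> u t @[t --> U] --> x -> (\forall t \near U, y <= u t) -> y <= x.
Proof.
by move=> PU ux h; apply: (ler_cvg_to (f := cst y) _ ux h); exact: cvg_cst.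
Qed.

(** The quadratic mean inequality along the path u, x, y, v. In each coordinate the defect is a sum
    of three squares. *)
Lemma sqn_sub_le3 (R : realType) (u v x y : R[i]) :
  sqn (u - v) <= 3 * sqn (x - u) + 3 * sqn (x - y) + 3 * sqn (y - v).
Proof.
have sos (i j l m : R) :
    (i - j) ^+ 2 <= 3 * (l - i) ^+ 2 + 3 * (l - m) ^+ 2 + 3 * (m - j) ^+ 2.
  rewrite -subr_ge0 (_ : _ - _ = (i - 2 * l + m) ^+ 2 + (l - 2 * m + j) ^+ 2 +
    (i - l - m + j) ^+ 2); last by ring.
  by rewrite !addr_ge0 ?sqr_ge0.
rewrite /sqn !ReD !ImD !ReN !ImN.
have := lerD (sos (complex.Re u) (complex.Re v) (complex.Re x) (complex.Re y))
  (sos (complex.Im u) (complex.Im v) (complex.Im x) (complex.Im y)).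
by move/le_trans; apply; rewrite le_eqVlt; apply/orP; left; apply/eqP; ring.
Qed.

Section Solutions.
Variables (R : realType) (k n p : nat) (ns : 'I_k -> nat).
Variables C B : 'I_k -> 'M[R[i]]_p.
Hypothesis CB : forall b, C b = (B b)^t* *m B b.
Hypotheses (n_gt0 : (0 < n)%N) (p_gt0 : (0 < p)%N).
Hypothesis ns_gt0 : forall a, (0 < ns a)%N.

Local Notation c0 := (dim_ratio R n p).
Local Notation c := (class_ratio R n ns).
Local Notation arg := (resolvent_arg n ns C).
Local Notation T := (fixmap n ns C).
Implicit Types (z : R[i]) (g h : 'rV[R[i]]_k) (a b : 'I_k).

Let c0_gt0 : 0 < c0. Proof. exact: dim_ratio_gt0. Qed.

Let c0C : (c0%:C : R[i]) != 0.
Proof. by rewrite (fmorph_eq0 (real_complex R)) gt_eqF. Qed.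

Lemma den_gtilde z g a : z != 0 -> den n ns C z g a = - z * (1 + gtilde n ns C z g a).
Proof.
move=> z0; rewrite /den /gtilde mulrDr mulr1; congr (_ + _).
by rewrite mulrA mulrNN mulfV // mul1r.
Qed.

Lemma mul_fixmap z g a : z != 0 ->
  c0%:C * T z g 0 a = - z^-1 * (1 + gtilde n ns C z g a)^-1.
Proof.
move=> z0; rewrite mxE [(c0%:C * _)^-1]invfM mulrA mulfV // mul1r.
by rewrite den_gtilde // invfM invrN.
Qed.

(** Conversely, for a fixed point in the domain, the bound on c0 |g_a| comes from |[den]| >= Im z,
    and the two nondegeneracy conditions from [arg_unit] and [den_neq0]. *)
Lemma solution_fixmap z g : 0 < complex.Im z ->
  solution n ns C z g <-> half_plane_dom z g /\ g = T z g.
Proof.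
move=> z_gt0; have z0 : z != 0 by apply: Im_neq0; rewrite gt_eqF.
split => [hg|[g_dom hg] a].
  split => [b|]; first by have [[]] := hg b; rewrite !pmulr_rge0.
  apply/rowP => a; have [_ [_ h1 h2]] := hg a.
  by apply: (mulfI c0C); rewrite h2 mul_fixmap.
have [h1 h2] := g_dom a.
have d0 := den_neq0 CB n_gt0 p_gt0 ns_gt0 z_gt0 g_dom a.
split; split.
- by rewrite pmulr_rge0.
- by rewrite pmulr_rge0.
- rewrite normr_normc -realCM lecR (gtr0_norm z_gt0) {1}hg.
  exact: (normc_fixmap CB n_gt0 p_gt0 ns_gt0 z_gt0 g_dom a).
- exact: (arg_unit CB n_gt0 ns_gt0 z_gt0 g_dom).
- by move: d0; rewrite den_gtilde // mulf_eq0 negb_or => /andP[].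
- by rewrite {1}hg mul_fixmap.
Qed.

(** Fixed points have positive imaginary parts, so the ratios F are well defined; contraction at the
    largest one gives F(b0) <= rate^2 F(b0), which forces it to vanish. *)
Lemma fixmap_unique z g h : (0 < k)%N -> 0 < complex.Im z ->
  half_plane_dom z g -> half_plane_dom z h -> g = T z g -> h = T z h -> g = h.
Proof.
move=> k_gt0 z_gt0 g_dom h_dom hg hh.
have gp b : 0 < complex.Im (g 0 b).
  by rewrite hg (Im_fixmap_gt0 CB n_gt0 p_gt0 ns_gt0 z_gt0 g_dom).
have hp b : 0 < complex.Im (h 0 b).
  by rewrite hh (Im_fixmap_gt0 CB n_gt0 p_gt0 ns_gt0 z_gt0 h_dom).
have ghp b : 0 < complex.Im (g 0 b) * complex.Im (h 0 b) by rewrite mulr_gt0.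
pose F b := sqn (g 0 b - h 0 b) / (complex.Im (g 0 b) * complex.Im (h 0 b)).
have [b0 hb0] := finite_max (Ordinal k_gt0) F.
have F_ge0 b : 0 <= F b by rewrite divr_ge0 ?sqn_ge0 // ltW.
have := fixmap_contract CB n_gt0 p_gt0 ns_gt0 z_gt0 g_dom h_dom (F_ge0 b0) gp.
have dist b : sqn (g 0 b - h 0 b) <=
    F b0 * (complex.Im (g 0 b) * complex.Im (h 0 b)).
  by rewrite -ler_pdivrMr ?ghp //; exact: hb0.
move=> /(_ dist b0); rewrite -hg -hh -ler_pdivrMr // -/(F b0) => hF.
have r0 := rate_ge0 C p_gt0 z_gt0; have r1 := rate_lt1 C p_gt0 z_gt0.
have r2 : rate C z ^+ 2 < 1 by rewrite expr_lt1.
have F0 : F b0 <= 0.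
  rewrite leNgt; apply/negP => Fp; move: hF.
  by rewrite -[leLHS]mul1r ler_pM2r // leNgt r2.
apply/rowP => b; apply/eqP; rewrite -subr_eq0 -sqn_eq0 eq_le sqn_ge0 andbT.
apply: le_trans (dist b) _; rewrite pmulr_lle0 //.
Qed.

(** * Reflection of solutions to the conjugate half plane *)

Section Conjugation.
Implicit Types (u : R[i]).

Definition conj_row g : 'rV[R[i]]_k := map_mx (@conjc R) g.

(** The C_b are Hermitian, so only the coefficients are conjugated in the adjoint. *)
Lemma arg_conj g : arg (conj_row g) = (arg g)^t*.
Proof.
rewrite /resolvent_arg (adj_pencil CB 1); congr (_ + _).
  by congr (_%:M); exact: esym (conjc1 R).
apply: eq_bigr => b _; rewrite mxE; congr (_ *: _).
by rewrite [in RHS]rmorphM; congr (_ * _); exact: esym (conjc_real _).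
Qed.

Lemma gtilde_conj z g a : arg g \in unitmx ->
  gtilde n ns C z^*%C (conj_row g) a = (gtilde n ns C z g a)^*%C.
Proof.
move=> ug; rewrite /gtilde arg_conj.
have -> : invmx ((arg g)^t* ) = (invmx (arg g))^t*.
  by apply: invmx_unique; rewrite -adjM mulVmx // trmx1 map_mx1.
have -> : \tr (C a *m (invmx (arg g))^t* ) = (\tr (C a *m invmx (arg g)))^*%C.
  by rewrite -tr_adj adjM mxtrace_mulC CB adjM adjK.
rewrite !conjcM conjcN -conjc_inv.
by rewrite natrC realCV conjc_real.
Qed.

Lemma solution_conj z g : solution n ns C z g ->
  solution n ns C z^*%C (conj_row g).
Proof.
move=> hg a; have [[h1 h2 h3] [h4 h5 h6]] := hg a.
have gE : conj_row g 0 a = (g 0 a)^*%C by rewrite mxE.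
split; split.
- by rewrite gE !Im_conjc mulrNN.
- by rewrite gE -conjcM !Im_conjc mulrNN.
- by rewrite gE normcJ Im_conjc normrN.
- by rewrite arg_conj map_unitmx unitmx_tr.
- rewrite gtilde_conj // -{1}(conjc1 R) -conjcD.
  by rewrite conjc_eq0.
- rewrite gtilde_conj // gE -{1}(conjc1 R) -conjcD.
  rewrite -!conjc_inv -conjcN -conjcM -h6.
  by rewrite conjcM conjc_real.
Qed.

Lemma conj_rowK : involutive conj_row.
Proof. by move=> g; apply/rowP => a; rewrite !mxE conjcK. Qed.

End Conjugation.

(** * Limits of the iterates are fixed points *)

Section Limit.
Variable z : R[i].
Hypothesis z_gt0 : 0 < complex.Im z.
Local Notation it := (iterate n ns C z).

Let it_dom t : half_plane_dom z (it t).
Proof. exact: (iterate_dom CB n_gt0 p_gt0 ns_gt0 z_gt0). Qed.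

Let it_gt0 t b : 0 < complex.Im (it t 0 b).
Proof. exact: (Im_iterate_gt0 CB n_gt0 p_gt0 ns_gt0 z_gt0). Qed.

Let Im_it_le t b : complex.Im (it t 0 b) <= c0^-1 * (complex.Im z)^-1.
Proof.
rewrite ler_pdivlMl //; apply: le_trans (normc_iterate CB n_gt0 p_gt0 ns_gt0 z_gt0 t b).
by rewrite ler_pM2l // (le_trans (ler_norm _)) // le_Im_normc.
Qed.

Lemma iterate_increment : exists D : R, forall t b,
  sqn (it t.+1 0 b - it t 0 b) <= D * (rate C z ^+ 2) ^+ t.
Proof.
(* The sum dominates the largest of the initial ratios and needs no choice of an index. *)
pose tau := \sum_b sqn (it 1%N 0 b - it 0%N 0 b) /
   (complex.Im (it 1%N 0 b) * complex.Im (it 0%N 0 b)).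
have tau_ge0 : 0 <= tau.
  by apply: sumr_ge0 => b _; rewrite divr_ge0 ?sqn_ge0 // mulr_ge0 // ltW.
have r0 : 0 <= rate C z ^+ 2 by exact: sqr_ge0.
have key t b : sqn (it t.+1 0 b - it t 0 b) <=
    (rate C z ^+ 2) ^+ t * tau * (complex.Im (it t.+1 0 b) * complex.Im (it t 0 b)).
  elim: t b => [|t IH] b; last first.
    rewrite [(rate C z ^+ 2) ^+ t.+1]exprS -(mulrA (rate C z ^+ 2)).
    apply: (fixmap_contract CB n_gt0 p_gt0 ns_gt0 z_gt0 (it_dom t.+1) (it_dom t)
      _ (it_gt0 t.+1) IH).
    by rewrite mulr_ge0 // exprn_ge0.
  rewrite expr0 mul1r -ler_pdivrMr ?mulr_gt0 // /tau (bigD1 b) // lerDl.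
  by apply: sumr_ge0 => b' _; rewrite divr_ge0 ?sqn_ge0 // mulr_ge0 // ltW.
exists (tau * (c0^-1 * (complex.Im z)^-1) ^+ 2) => t b.
apply: le_trans (key t b) _; rewrite [leRHS]mulrC [leRHS]mulrA.
apply: ler_wpM2l; first by rewrite mulr_ge0 // exprn_ge0.
by rewrite expr2; apply: ler_pM; rewrite // ltW.
Qed.

Variables (U : set_system nat) (G : 'rV[R[i]]_k).
Hypotheses (PU : ProperFilter U) (U_oo : \oo `<=` U).
Hypothesis ReG : forall b, complex.Re (it t 0 b) @[t --> U] --> complex.Re (G 0 b).
Hypothesis ImG : forall b, complex.Im (it t 0 b) @[t --> U] --> complex.Im (G 0 b).

Let ImG_ge b : fixmap_lower n C z <= complex.Im (G 0 b).
Proof.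
apply: (cvg_lower_bound PU (@ImG b)).
(* The lower bound holds for values of T, hence from the first iterate on and not at the starting
   point. *)
apply: U_oo; exists 1%N => //= -[//|t] _ /=.
exact: (Im_fixmap_ge CB n_gt0 p_gt0 ns_gt0 z_gt0 (it_dom t)).
Qed.

Let low_gt0 : 0 < fixmap_lower n C z.
Proof. exact: fixmap_lower_gt0. Qed.

Let ImG_gt0 b : 0 < complex.Im (G 0 b).
Proof. exact: lt_le_trans low_gt0 (ImG_ge b). Qed.

Lemma limit_dom : half_plane_dom z G.
Proof.
move=> b; split; first exact/ltW.
have h : complex.Im (z * it t 0 b) @[t --> U] --> complex.Im (z * G 0 b).
  have -> : complex.Im (z * G 0 b) = complex.Re z * complex.Im (G 0 b) +
     complex.Im z * complex.Re (G 0 b) by case: (z) (G 0 b) => ? ? [? ?].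
  rewrite (_ : (fun t => _) = (fun t => complex.Re z * complex.Im (it t 0 b) +
     complex.Im z * complex.Re (it t 0 b))); last first.
    by apply/funext => t; case: (z) (it t 0 b) => ? ? [? ?].
  by apply: cvgD; apply: cvgM => //; exact: cvg_cst.
apply: (cvg_lower_bound PU h); apply: nearW => t /=.
by case: (it_dom t b).
Qed.

Let sqn_cvg b : sqn (it t 0 b - G 0 b) @[t --> U] --> (0 : R).
Proof.
have h (x : nat -> R) (y : R) : x t @[t --> U] --> y ->
    (x t - y) ^+ 2 @[t --> U] --> (0 : R).
  move=> xy; have d : (x t - y) @[t --> U] --> (0 : R).
    by rewrite -(subrr y); apply: cvgB => //; exact: cvg_cst.
  by rewrite -(mulr0 (0 : R)); under eq_fun do rewrite expr2; exact: cvgM.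
rewrite -(addr0 (0 : R)) /sqn.
under eq_fun do rewrite ReD ImD ReN ImN.
by apply: cvgD; apply: h.
Qed.

Let increment_cvg b : sqn (it t.+1 0 b - it t 0 b) @[t --> U] --> (0 : R).
Proof.
have [D hD] := iterate_increment.
have r0 := rate_ge0 C p_gt0 z_gt0; have r1 := rate_lt1 C p_gt0 z_gt0.
have h : D * (rate C z ^+ 2) ^+ t @[t --> \oo] --> (0 : R).
  rewrite -(mulr0 D); apply: cvgM; first exact: cvg_cst.
  by apply: cvg_expr; rewrite ger0_norm ?exprn_ge0 // expr_lt1.
have hU : D * (rate C z ^+ 2) ^+ t @[t --> U] --> (0 : R).
  by move=> A /h hA; exact: U_oo.
apply: (squeeze_cvgr _ (cvg_cst 0) hU); apply: nearW => t.
by rewrite sqn_ge0 hD.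
Qed.

(** The contraction estimate between the iterates and G stands in for continuity of T: as tau_t
    tends to 0 along U, the successors of the iterates tend to T(G). The increments also vanish, so
    the distance from G to T(G) is 0. *)
Lemma limit_fixed : G = T z G.
Proof.
have G_dom := limit_dom.
have ubound : 0 <= c0^-1 * (complex.Im z)^-1.
  by rewrite mulr_ge0 ?invr_ge0 // ltW.
pose low := fixmap_lower n C z.
pose tau t := (\sum_b sqn (it t 0 b - G 0 b)) / low ^+ 2.
have tau_ge0 t : 0 <= tau t.
  by rewrite divr_ge0 ?sqr_ge0 //; apply: sumr_ge0 => b _; exact: sqn_ge0.
have tau_cvg : tau t @[t --> U] --> (0 : R).
  rewrite -(mul0r (low ^+ 2)^-1); apply: cvgM; last exact: cvg_cst.
  rewrite [X in _ --> X](_ : _ = \sum_(b < k) (0 : R)); last by rewrite big1.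
  elim: (index_enum _) => [|b s IH].
    under eq_fun do rewrite big_nil.
    by rewrite big_nil; exact: cvg_cst.
  under eq_fun do rewrite big_cons.
  by rewrite big_cons; apply: cvgD.
apply/rowP => a; apply/esym/eqP; rewrite -subr_eq0 -sqn_eq0 eq_le sqn_ge0 andbT.
pose X := complex.Im (T z G 0 a).
have step t : (0 < t)%N -> sqn (it t.+1 0 a - T z G 0 a) <=
    rate C z ^+ 2 * tau t * (c0^-1 * (complex.Im z)^-1 * X).
  case: t => [//|t] _.
  have hc := @fixmap_contract _ _ _ _ _ _ _ CB n_gt0 p_gt0 ns_gt0 z z_gt0
    (it t.+1) G (tau t.+1) (it_dom _) G_dom (tau_ge0 _) (it_gt0 _).
  apply: le_trans (hc _ a) _ => [b|].
    apply: (@le_trans _ _ (tau t.+1 * low ^+ 2)).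
      rewrite divfK ?gt_eqF ?exprn_gt0 // (bigD1 b) //= lerDl.
      by apply: sumr_ge0 => b' _; exact: sqn_ge0.
    apply: ler_wpM2l => //; rewrite expr2; apply: ler_pM => //; try exact: ltW.
    exact: (Im_fixmap_ge CB n_gt0 p_gt0 ns_gt0 z_gt0 (it_dom t)).
  apply: ler_wpM2l; first by rewrite mulr_ge0 ?sqr_ge0.
  apply: ler_wpM2r; last exact: Im_it_le t.+2 a.
  exact/ltW/(Im_fixmap_gt0 CB n_gt0 p_gt0 ns_gt0 z_gt0 G_dom).
pose E t := 3 * (rate C z ^+ 2 * tau t * (c0^-1 * (complex.Im z)^-1 * X)) +
  3 * sqn (it t.+1 0 a - it t 0 a) + 3 * sqn (it t 0 a - G 0 a).
have E_cvg : E t @[t --> U] --> (0 : R).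
  rewrite (_ : 0 = 3 * (rate C z ^+ 2 * 0 * (c0^-1 * (complex.Im z)^-1 * X)) +
     3 * 0 + 3 * 0); last by rewrite !(mulr0, mul0r, addr0).
  apply: cvgD; first apply: cvgD.
  - apply: cvgM; first exact: cvg_cst.
    apply: cvgM; last exact: cvg_cst.
    by apply: cvgM => //; exact: cvg_cst.
  - by apply: cvgM => //; exact: cvg_cst.
  - by apply: cvgM => //; exact: cvg_cst.
apply: (cvg_lower_bound PU E_cvg).
apply: U_oo; exists 1%N => //= t t0; rewrite /E.
apply: (@le_trans _ _ (3 * sqn (it t.+1 0 a - T z G 0 a) +
  3 * sqn (it t.+1 0 a - it t 0 a) + 3 * sqn (it t 0 a - G 0 a))); last first.
  by rewrite lerD2r lerD2r ler_pM2l // step.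
exact: sqn_sub_le3.
Qed.

End Limit.

End Solutions.

(** * The Stieltjes kernel and the construction of the limit laws *)

Section StieltjesKernel.
Variables (R : realType) (z : R[i]).
Hypothesis z0 : complex.Im z != 0.

Let y_gt0 : 0 < `|complex.Im z|. Proof. by rewrite normr_gt0. Qed.

Lemma normc_kernel_bound (t : R) : normc ((t%:C - z)^-1) <= `|complex.Im z|^-1.
Proof.
rewrite normcV lef_pV2 ?posrE //.
  apply: le_trans (le_Im_normc _).
  by rewrite ImD ImN /= add0r normrN.
by rewrite lt0r normc_ge0 normc_eq0 real_sub_neq0.
Qed.

(** The difference is the product of the two kernels and t - s. Boundedness and Lipschitz continuity
    are what [law_selection] asks of a test function. *)
Lemma normc_kernel_lipschitz (s t : R) :
  normc ((s%:C - z)^-1 - (t%:C - z)^-1) <= `|complex.Im z|^-1 ^+ 2 * `|s - t|.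
Proof.
have s0 := real_sub_neq0 s z0; have t0 := real_sub_neq0 t z0.
have -> : (s%:C - z)^-1 - (t%:C - z)^-1 =
    (s%:C - z)^-1 * (t%:C - z)^-1 * (t - s)%:C.
  by rewrite realCD realCN; field; rewrite s0 t0.
rewrite !normcM normc_real distrC ler_wpM2r // expr2.
by apply: ler_pM; rewrite ?normc_ge0 ?normc_kernel_bound.
Qed.

Lemma Re_kernel_bound (t : R) :
  `|complex.Re ((t%:C - z)^-1)| <= `|complex.Im z|^-1.
Proof. exact: le_trans (le_Re_normc _) (normc_kernel_bound t). Qed.

Lemma Im_kernel_bound (t : R) :
  `|complex.Im ((t%:C - z)^-1)| <= `|complex.Im z|^-1.
Proof. exact: le_trans (le_Im_normc _) (normc_kernel_bound t). Qed.

Lemma Re_kernel_lipschitz (s t : R) :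
  `|complex.Re ((s%:C - z)^-1) - complex.Re ((t%:C - z)^-1)| <=
    `|complex.Im z|^-1 ^+ 2 * `|s - t|.
Proof.
by rewrite -ReN -ReD; exact: le_trans (le_Re_normc _) (normc_kernel_lipschitz s t).
Qed.

Lemma Im_kernel_lipschitz (s t : R) :
  `|complex.Im ((s%:C - z)^-1) - complex.Im ((t%:C - z)^-1)| <=
    `|complex.Im z|^-1 ^+ 2 * `|s - t|.
Proof.
by rewrite -ImN -ImD; exact: le_trans (le_Im_normc _) (normc_kernel_lipschitz s t).
Qed.

Lemma stieltjes_conj (nu : probability (measurableTypeR R) R) :
  stieltjes nu z^*%C = (stieltjes nu z)^*%C.
Proof.
have kE (t : R) : (t%:C - z^*%C)^-1 = ((t%:C - z)^-1)^*%C.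
  by rewrite conjc_inv conjcD conjcN conjc_real.
rewrite /stieltjes /=; congr (_ +i* _).
  by apply: eq_Rintegral => t _; rewrite kE; case: (_^-1).
rewrite (_ : \int[nu]_t _ = \int[nu]_t (-1 * complex.Im ((t%:C - z)^-1))).
  rewrite RintegralZl ?mulN1r //.
  apply: (probability_bounded_integrable nu) Im_kernel_bound.
  exact: lipschitz_measurable Im_kernel_lipschitz.
by apply: eq_Rintegral => t _; rewrite kE Im_conjc mulN1r.
Qed.

End StieltjesKernel.

Section Existence.
Variables (R : realType) (k n p : nat) (ns : 'I_k -> nat).
Variables C B : 'I_k -> 'M[R[i]]_p.
Hypothesis CB : forall b, C b = (B b)^t* *m B b.
Hypotheses (n_gt0 : (0 < n)%N) (p_gt0 : (0 < p)%N).
Hypothesis ns_gt0 : forall a, (0 < ns a)%N.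

Local Notation c0 := (dim_ratio R n p).

(** The atoms and weights do not depend on z, so each nu_a is selected once and serves every z of
    the upper half plane, with no extraction for individual z. *)
Lemma iterate_limit_laws (U : set_system nat) : UltraFilter U ->
  exists nu : 'I_k -> probability (measurableTypeR R) R,
    forall a, compactly_supported_in (nu a) [set x | 0 <= x] /\
      forall z, 0 < complex.Im z ->
        (complex.Re (iterate n ns C z t 0 a) @[t --> U] -->
           complex.Re ((c0^-1)%:C * stieltjes (nu a) z)) /\
        (complex.Im (iterate n ns C z t 0 a) @[t --> U] -->
           complex.Im ((c0^-1)%:C * stieltjes (nu a) z)).
Proof.
move=> UU; have c0_gt0 : 0 < c0 by exact: dim_ratio_gt0.
(* The number of atoms varies with t, hence a dependent pair. *)
pose data := {m : nat & ('I_k -> 'I_m -> R) * ('I_k -> 'I_m -> R)}%type.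
have /choice[D hD] t : exists d : data,
  [/\ forall a j, 0 <= (projT2 d).1 a j, forall a, \sum_j (projT2 d).1 a j = 1,
    forall a j, 0 <= (projT2 d).2 a j <= support_bound n ns C &
    forall z, complex.Im z != 0 -> forall a,
      c0%:C * iterate n ns C z t 0 a =
        stieltjes_sum ((projT2 d).1 a) ((projT2 d).2 a) z].
  have [m [w [l h]]] := iterate_stieltjes_sum CB n_gt0 p_gt0 ns_gt0 t.
  by exists (existT _ m (w, l)).
have r0 : 0 <= support_bound n ns C by exact/ltW/support_bound_gt0.
pose w a t := (projT2 (D t)).1 a; pose l a t := (projT2 (D t)).2 a.
have /choice[nu hnu] a : exists nu : probability (measurableTypeR R) R,
  compactly_supported_in nu [set x | 0 <= x] /\
  forall (f : R -> R) (K c : R), (forall x y, `|f x - f y| <= K * `|x - y|) ->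
    (forall t, `|f t| <= c) ->
    \sum_j w a t j * f (l a t j) @[t --> U] --> \int[nu]_t f t.
  apply: (law_selection r0 UU) => t.
  - by move=> j; have [h _ _ _] := hD t; exact: h.
  - by have [_ h _ _] := hD t; exact: h.
  - by move=> j; have [_ _ h _] := hD t; exact: h.
exists nu => a; have [supp hlim] := hnu a; split => // z z_gt0.
have z0 : complex.Im z != 0 by rewrite gt_eqF.
have itE t : iterate n ns C z t 0 a = (c0^-1)%:C * stieltjes_sum (w a t) (l a t) z.
  have [_ _ _ h] := hD t; rewrite -h // mulrA -realCM mulVf ?gt_eqF //.
  by rewrite mul1r.
split.
- under eq_fun do rewrite itE ReZ /stieltjes_sum Re_sum.
  rewrite ReZ /stieltjes; apply: cvgM; first exact: cvg_cst.
  under eq_fun do under eq_bigr do rewrite ReZ.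
  exact: hlim (Re_kernel_lipschitz z0) (Re_kernel_bound z0).
- under eq_fun do rewrite itE ImZ /stieltjes_sum Im_sum.
  rewrite ImZ /stieltjes; apply: cvgM; first exact: cvg_cst.
  under eq_fun do under eq_bigr do rewrite ImZ.
  exact: hlim (Im_kernel_lipschitz z0) (Im_kernel_bound z0).
Qed.

End Existence.

Theorem proposition3 (R : realType) (k n p : nat) (ns : 'I_k -> nat)
    (C : 'I_k -> 'M[R[i]]_p)
    (k_gt0 : (0 < k)%N) (n_gt0 : (0 < n)%N) (p_gt0 : (0 < p)%N)
    (ns_gt0 : forall a, (0 < ns a)%N) (sum_ns : (\sum_(a < k) ns a)%N = n)
    (C_psd : forall a, psdmx (C a)) :
  exists g : R[i] -> 'rV[R[i]]_k,
    [/\ forall z, complex.Im z != 0 -> unique (solution n ns C z) (g z),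
        forall z, complex.Im z != 0 -> forall a,
          0 < complex.Im z * complex.Im (g z 0 a) /\
          (C a != 0 -> 0 < complex.Im z * complex.Im (z * g z 0 a)) &
        exists nu : 'I_k -> probability (measurableTypeR R) R,
          forall a,
            compactly_supported_in (nu a) [set x | 0 <= x] /\
            forall z, complex.Im z != 0 ->
              (dim_ratio R n p)%:C * g z 0 a = stieltjes (nu a) z].
Proof.
have /choice[B CB] b : exists B : 'M[R[i]]_p, C b = B^t* *m B.
  exact: psdmx_factor (C_psd b).
(* An ultrafilter finer than the eventual filter takes the place of a convergent subsequence. *)
have [U [UU U_oo]] := ultraFilterLemma (@eventually_filter).
have [nu hnu] := iterate_limit_laws CB n_gt0 p_gt0 ns_gt0 UU.
have c0_gt0 := dim_ratio_gt0 R n_gt0 p_gt0.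
(* Defined from the laws for all z, so that the last claim is immediate; in the upper half plane
   this is the limit of the iterates along U. *)
pose g z : 'rV[R[i]]_k :=
  \row_a (((dim_ratio R n p)^-1)%:C * stieltjes (nu a) z).
have PU : ProperFilter U by exact: ultra_proper.
have ReG z b : 0 < complex.Im z ->
    complex.Re (iterate n ns C z t 0 b) @[t --> U] --> complex.Re (g z 0 b).
  by move=> z_gt0; rewrite mxE; have [_ /(_ z z_gt0)[]] := hnu b.
have ImG z b : 0 < complex.Im z ->
    complex.Im (iterate n ns C z t 0 b) @[t --> U] --> complex.Im (g z 0 b).
  by move=> z_gt0; rewrite mxE; have [_ /(_ z z_gt0)[]] := hnu b.
have g_dom z : 0 < complex.Im z -> half_plane_dom z (g z).
  move=> z_gt0; apply: (limit_dom CB n_gt0 p_gt0 ns_gt0 z_gt0 PU U_oo).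
  - by move=> b; exact: ReG.
  - by move=> b; exact: ImG.
have g_fixed z : 0 < complex.Im z -> g z = fixmap n ns C z (g z).
  move=> z_gt0; apply: (limit_fixed CB n_gt0 p_gt0 ns_gt0 z_gt0 PU U_oo).
  - by move=> b; exact: ReG.
  - by move=> b; exact: ImG.
have upper z : 0 < complex.Im z -> unique (solution n ns C z) (g z).
  move=> z_gt0; have solE := solution_fixmap CB n_gt0 p_gt0 ns_gt0 _ z_gt0.
  split; first by apply/solE; split; [exact: g_dom|exact: g_fixed].
  move=> h /solE[h_dom h_fixed].
  exact: (fixmap_unique CB n_gt0 p_gt0 ns_gt0 k_gt0 z_gt0 (g_dom z z_gt0) h_dom
    (g_fixed z z_gt0) h_fixed).
(* Stieltjes transforms commute with conjugation, which carries the results from the upper half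
   plane to the lower one. *)
have g_conj z : complex.Im z != 0 -> g z^*%C = conj_row (g z).
  move=> z0; apply/rowP => a; rewrite !mxE stieltjes_conj //.
  by rewrite conjcM conjc_real.
have strict z a : 0 < complex.Im z -> 0 < complex.Im (g z 0 a) /\
    (C a != 0 -> 0 < complex.Im (z * g z 0 a)).
  move=> z_gt0; rewrite (g_fixed z z_gt0); split => [|Ca0].
    exact: (Im_fixmap_gt0 CB n_gt0 p_gt0 ns_gt0 z_gt0 (g_dom z z_gt0)).
  exact: (Im_z_fixmap_gt0 CB n_gt0 p_gt0 ns_gt0 z_gt0 (g_dom z z_gt0) Ca0).
exists g; split.
- move=> z; rewrite neq_lt => /orP[z_lt0|]; last exact: upper.
  have zc_gt0 : 0 < complex.Im z^*%C by rewrite Im_conjc oppr_gt0.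
  have zc0 : complex.Im z^*%C != 0 by rewrite gt_eqF.
  have [sol uniq] := upper _ zc_gt0.
  have gE : g z = conj_row (g z^*%C) by rewrite -g_conj // conjcK.
  rewrite gE; split.
    by rewrite -{1}(conjcK z); apply: (solution_conj CB).
  move=> h /(solution_conj CB) /uniq ->; exact: conj_rowK.
- move=> z; rewrite neq_lt => /orP[z_lt0|z_gt0] a; last first.
    have [h1 h2] := strict z a z_gt0.
    by split => [|/h2 ?]; exact: mulr_gt0.
  have zc_gt0 : 0 < complex.Im z^*%C by rewrite Im_conjc oppr_gt0.
  have [h1 h2] := strict _ a zc_gt0.
  have gE : g z^*%C 0 a = (g z 0 a)^*%C by rewrite g_conj ?lt_eqF // mxE.
  rewrite gE -?conjcM Im_conjc oppr_gt0 in h1 h2.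
  split; first by rewrite nmulr_rgt0.
  by move=> /h2; rewrite Im_conjc oppr_gt0 nmulr_rgt0.
- exists nu => a; have [supp _] := hnu a; split => // z z0.
  by rewrite mxE mulrA -realCM mulfV ?gt_eqF // mul1r.
Qed.
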